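(* Let $d\ge 2$ and $k=2$. Let $(G_n)_{n}$ be either the sequence of tori $\mathbb{T}_n^d=(\mathbb{Z}/n\mathbb{Z})^d$ or the sequence of boxes $[n]^d$. Let $\mathcal{C}_n$ be the event of complete occupation in $2$-neighbour bootstrap percolation on $G_n$, let $f^{\mathcal{C}}_n:\{-1,1\}^{V(G_n)}\to\{-1,1\}$ be the corresponding Boolean function, and let $p_c(n)=p_c(G_n,2)$ be the critical density. Then $\mathcal{C}_n$ is noise sensitive in the following sense: for every sequence $\epsilon_n\in(0,1]$ with $\epsilon_n\gg \log\log n/\log n$ (i.e. $\epsilon_n\log n/\log\log n\to\infty$ as $n\to\infty$), $$\lim_{n\to\infty}\mathrm{Corr}_{p_c(n)}\big(f^{\mathcal{C}}_n(\omega),f^{\mathcal{C}}_n(\omega^{\epsilon_n})\big)=0 .$$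
   Context: Graphs: $[n]^d=\{1,\dots,n\}^d$ is the box with nearest-neighbour edges inherited from $\mathbb{Z}^d$, and $\mathbb{T}_n^d=(\mathbb{Z}/n\mathbb{Z})^d$ is the torus with nearest-neighbour edges (two vertices are adjacent if they differ by $\pm1$ in exactly one coordinate and agree in all others; on the torus, arithmetic is modulo $n$). Bootstrap percolation: given a finite graph $G=(V,E)$ and an integer $k$, an initial configuration $\omega\in\{-1,1\}^{V}$ declares the vertex $v$ initially occupied if $\omega(v)=1$ and vacant if $\omega(v)=-1$. Repeatedly, any vacant vertex having at least $k$ occupied neighbours becomes occupied (occupied vertices stay occupied), until no more changes occur. Complete occupation is the event that every vertex of $G$ is eventually occupied; it is determined by $\omega$, and is identified with the Boolean function $f^{\mathcal{C}}$ with $f^{\mathcal{C}}(\omega)=1$ if complete occupation happens from $\omega$ and $f^{\mathcal{C}}(\omega)=-1$ otherwise. $\mathbb{P}_p$ denotes the product measure on $\{-1,1\}^V$ under which each bit is independently $1$ with probability $p$ and $-1$ with probability $1-p$. Critical density of a finite graph: $p_c(G,k)$ is the infimum of those $p\in[0,1]$ for which the $\mathbb{P}_p$-probability of complete occupation in $k$-neighbour bootstrap percolation on $G$ is at least $1/2$. Noise: $\omega$ has law $\mathbb{P}_{p_c(n)}$, and $\omega^{\epsilon}$ is obtained from $\omega$ by independently resampling each bit with probability $\epsilon$: each bit is, independently with probability $\epsilon$, replaced by a fresh independent bit which is $1$ with probability $p_c(n)$ and $-1$ otherwise, and is left unchanged with probability $1-\epsilon$. $\mathrm{Corr}(X,Y)=\mathrm{Cov}(X,Y)/\sqrt{\mathrm{Var}(X)\mathrm{Var}(Y)}$;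 $\mathrm{Corr}_{p_c(n)}$ is computed with respect to the joint law of $(\omega,\omega^{\epsilon_n})$. *)

(* Defs.v *)
From HB Require Import structures.
From mathcomp Require Import all_boot all_order all_algebra.
From mathcomp Require Import all_classical all_reals all_analysis.
Set Implicit Arguments.
Unset Strict Implicit.
Unset Printing Implicit Defensive.
Import Order.TTheory GRing.Theory Num.Theory.
Import numFieldNormedType.Exports.
Local Open Scope ring_scope.

Inductive lattice := Torus | Box.

Definition vertex (d n : nat) := {ffun 'I_d -> 'I_n}.

(* One-dimensional adjacency. [ordS] is the cyclic successor on ['I_n]; the
   clause [a != b] only matters for n = 1, where it excludes a loop. *)
Definition adj1 (L : lattice) (n : nat) : rel 'I_n := fun a b =>
  match L with
  | Torus => (a != b) && ((ordS a == b) || (ordS b == a))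
  | Box => (a.+1 == b)%N || (b.+1 == a)%N
  end.

Definition adj (L : lattice) (d n : nat) : rel (vertex d n) := fun x y =>
  [exists i, adj1 L (x i) (y i) && [forall j, (j != i) ==> (x j == y j)]].

(* [true] encodes the bit 1 (occupied), [false] the bit -1 (vacant). *)
Definition config (V : finType) := {ffun V -> bool}.

Section Bootstrap.
Variables (V : finType) (e : rel V) (k : nat).

Definition bootstrap_step (A : {set V}) : {set V} :=
  A :|: [set v | (k <= #|[set u in A | e v u]|)%N].

Definition occupied_at (w : config V) (t : nat) : {set V} :=
  iter t bootstrap_step [set v | w v].

Definition complete_occupation (w : config V) : Prop :=
  forall v, exists t, v \in occupied_at w t.

Definition fC (R : realType) (w : config V) : R :=
  if `[< complete_occupation w >] then 1 else -1.

End Bootstrap.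

Arguments fC {V} e k R w.
Arguments adj L d n : clear implicits.

Local Open Scope classical_set_scope.

Section FiniteProbability.
Variables (R : realType) (T : finType) (mu : T -> R).

Definition Prob (A : T -> Prop) : R := \sum_(x : T | `[< A x >]) mu x.
Definition Expect (X : T -> R) : R := \sum_(x : T) mu x * X x.
Definition Cov (X Y : T -> R) : R :=
  Expect (fun x => (X x - Expect X) * (Y x - Expect Y)).
Definition Var (X : T -> R) : R := Cov X X.
Definition Corr (X Y : T -> R) : R := Cov X Y / Num.sqrt (Var X * Var Y).

End FiniteProbability.

Section Noise.
Variables (R : realType) (V : finType).

Definition product_law (p : R) (w : config V) : R :=
  \prod_(v : V) (if w v then p else 1 - p).

Definition p_c (e : rel V) (k : nat) : R :=
  inf [set p : R | 0 <= p <= 1 /\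
                   1 / 2 <= Prob (product_law p) (complete_occupation e k)].

(* A sample (w, s, w') consists of the configuration w, the set s of resampled
   vertices and the fresh bits w', all independent. *)
Definition noise_sample : finType := (config V * config V * config V)%type.

Definition noise_law (p eps : R) (x : noise_sample) : R :=
  let: (w, s, w') := x in
  product_law p w * product_law eps s * product_law p w'.

Definition omega (x : noise_sample) : config V := let: (w, _, _) := x in w.

Definition omega_eps (x : noise_sample) : config V :=
  let: (w, s, w') := x in [ffun v => if s v then w' v else w v].

Definition noise_corr (p eps : R) (f : config V -> R) : R :=
  Corr (noise_law p eps) (fun x => f (omega x)) (fun x => f (omega_eps x)).

End Noise.

Arguments p_c R {V} e k.

(* Main.v *)
(* Call a set generated if it is built from occupied vertices by joining adjacent
   generated sets and adding vertices with two neighbours in generated sets. When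
   C_n occurs, for every scale M there is a generated set whose largest projection
   has between M and 2M points. Conversely, take M = polylog(n). With overwhelming
   probability every axis-parallel segment of length about M/2 contains an occupied
   vertex, and then a generated set with a projection larger than M fills
   everything. So, up to negligible probability, C_n is the union of the local
   events "some cube of polylogarithmic side contains such a generated set".
   Disjoint cubes are independent, and P(C_n) = 1/2, so each local event has
   probability at most n^-d polylog(n). A vertex can be pivotal only if the local
   event holds around it, so its influence I satisfies the same bound.

   On the Fourier side, let X be the weight of f on the sets S of size at most K
   that contain a given vertex. The biased Bonami inequality E G^4 <= B^K (E G^2)^2
   for G of degree K, with B = 16 / (p (1 - p)) = polylog(n), gives X^2 <= 16 I^3 B^K.
   For K = c log n / loglog n with c small, B^K is at most n^(1/8), so n^d X tends
   to 0 and the weight on the levels 1..K vanishes. The other levels contribute at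
   most (1 - eps)^K, which vanishes because eps >> loglog n / log n. *)
Require Import Defs.
From HB Require Import structures.
From mathcomp Require Import all_boot all_order all_algebra.
From mathcomp Require Import all_classical all_reals all_analysis.
From mathcomp Require Import ring lra zify.
Set Implicit Arguments.
Unset Strict Implicit.
Unset Printing Implicit Defensive.
Import Order.TTheory GRing.Theory Num.Theory.
Import numFieldNormedType.Exports.
Import boot.fintype boot.finset.
Local Open Scope ring_scope.

(** * Finite probability *)

Section ExpectTheory.
Variables (R : realType) (T : finType) (mu : T -> R).
Implicit Types X Y : T -> R.
Local Notation E := (Expect mu).

Lemma eq_Expect X Y : X =1 Y -> E X = E Y.
Proof. by move=> eqXY; apply: eq_bigr => x _; rewrite eqXY. Qed.

Lemma ExpectD X Y : E (fun x => X x + Y x) = E X + E Y.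
Proof. by rewrite -big_split /=; apply: eq_bigr => x _; rewrite mulrDr. Qed.

Lemma ExpectZ c X : E (fun x => c * X x) = c * E X.
Proof. by rewrite /Expect mulr_sumr; apply: eq_bigr => x _; rewrite mulrCA. Qed.

Lemma ExpectB X Y : E (fun x => X x - Y x) = E X - E Y.
Proof.
rewrite -mulN1r -ExpectZ -ExpectD.
by apply: eq_Expect => x; rewrite mulN1r.
Qed.

Lemma Expect_sum (I : Type) (r : seq I) (P : pred I) (X : I -> T -> R) :
  E (fun x => \sum_(i <- r | P i) X i x) = \sum_(i <- r | P i) E (X i).
Proof.
rewrite /Expect exchange_big /=.
by apply: eq_bigr => x _; rewrite mulr_sumr.
Qed.

Lemma ProbE (A : T -> Prop) : Prob mu A = E (fun x => `[< A x >]%:R).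
Proof.
rewrite /Prob big_mkcond; apply: eq_bigr => x _.
by case: `[< A x >]; rewrite ?mulr1 ?mulr0.
Qed.

Hypothesis mu_ge0 : forall x, 0 <= mu x.

Lemma ler_Expect X Y : (forall x, X x <= Y x) -> E X <= E Y.
Proof. by move=> leXY; apply: ler_sum => x _; rewrite ler_wpM2l. Qed.

Lemma Expect_ge0 X : (forall x, 0 <= X x) -> 0 <= E X.
Proof. by move=> X0; apply: sumr_ge0 => x _; rewrite mulr_ge0. Qed.

Lemma Prob_ge0 (A : T -> Prop) : 0 <= Prob mu A.
Proof. exact: sumr_ge0. Qed.

Lemma ler_Prob (A B : T -> Prop) : (forall x, A x -> B x) -> Prob mu A <= Prob mu B.
Proof.
move=> AB; rewrite !ProbE; apply: ler_Expect => x.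
by rewrite ler_nat; case: asboolP => // /AB ?; rewrite asboolT.
Qed.

Lemma Prob_or (A B : T -> Prop) :
  Prob mu (fun x => A x \/ B x) <= Prob mu A + Prob mu B.
Proof.
rewrite !ProbE -ExpectD; apply: ler_Expect => x.
rewrite -natrD ler_nat; case: (asboolP (_ \/ _)) => // -[] ?.
  by rewrite asboolT.
by rewrite addnC asboolT.
Qed.

Lemma Prob_exists (I : finType) (A : I -> T -> Prop) :
  Prob mu (fun x => exists i, A i x) <= \sum_i Prob mu (A i).
Proof.
rewrite ProbE (eq_bigr (fun i => E (fun x => `[< A i x >]%:R))); last first.
  by move=> i _; rewrite ProbE.
rewrite -Expect_sum; apply: ler_Expect => x.
case: asboolP => [[i Ai]|_]; last exact: sumr_ge0.
rewrite (bigD1 i) //= asboolT // lerDl.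
exact: sumr_ge0.
Qed.

(** The quadratic form E (u X + v Y)^2 in (u, v) is nonnegative. Its values at (b, -c) and (-c, a)
    give the claim when b or a is positive; if both vanish, its values at (1, 1) and (1, -1) force c
    = 0. *)
Lemma Expect_CS X Y :
  (E (fun x => X x * Y x)) ^+ 2 <= E (fun x => X x ^+ 2) * E (fun x => Y x ^+ 2).
Proof.
set a := E (fun x => X x ^+ 2); set b := E (fun x => Y x ^+ 2).
set c := E (fun x => _).
have quad u v : 0 <= u ^+ 2 * a + 2 * u * v * c + v ^+ 2 * b.
  rewrite -!ExpectZ -!ExpectD; apply: Expect_ge0 => x.
  by have := sqr_ge0 (u * X x + v * Y x); congr (_ <= _); ring.
have a0 : 0 <= a by apply: Expect_ge0 => x; exact: sqr_ge0.
have b0 : 0 <= b by apply: Expect_ge0 => x; exact: sqr_ge0.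
have [b_gt0|b_le0] := ltP 0 b.
  have : 0 <= b * (a * b - c ^+ 2).
    by have := quad b (- c); congr (_ <= _); ring.
  by rewrite pmulr_rge0 // subr_ge0.
have {b_le0} bE : b = 0 by apply/eqP; rewrite eq_le b_le0.
have [a_gt0|a_le0] := ltP 0 a.
  have : 0 <= a * (a * b - c ^+ 2).
    by have := quad (- c) a; congr (_ <= _); ring.
  by rewrite pmulr_rge0 // subr_ge0.
have {a_le0} aE : a = 0 by apply/eqP; rewrite eq_le a_le0.
have := quad 1 1; have := quad 1 (-1).
rewrite aE bE => h1 h2; have -> : c = 0 by lra.
by rewrite expr0n /= mulr0.
Qed.

End ExpectTheory.

(** * Product measures and independence *)

Section ProductLaw.
Variables (R : realType) (V : finType) (p : R).
Implicit Types (w : config V) (U : {set V}).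
Local Notation mu := (product_law p).
Local Notation E := (Expect (@product_law R V p)).

Lemma Expect_prod (g : V -> bool -> R) :
  E (fun w => \prod_v g v (w v)) =
  \prod_v (p * g v true + (1 - p) * g v false).
Proof.
have -> : \prod_v (p * g v true + (1 - p) * g v false) =
    \prod_v \sum_(b : bool) (if b then p else 1 - p) * g v b.
  by apply: eq_bigr => v _; rewrite big_bool.
by rewrite bigA_distr_bigA /=; apply: eq_bigr => w _; rewrite -big_split.
Qed.

Lemma Expect_cst c : E (fun=> c) = c.
Proof.
have := Expect_prod (fun _ _ => 1); rewrite [X in _ = X]big1 => [E1|v _]; last by ring.
rewrite -[c in LHS]mulr1 ExpectZ -[RHS]mulr1; congr (_ * _).
by rewrite -[RHS]E1; apply: eq_Expect => w; rewrite big1.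
Qed.

Hypothesis p01 : 0 <= p <= 1.

Lemma product_law_ge0 w : 0 <= mu w.
Proof.
have /andP[p0 p1] := p01.
by apply: prodr_ge0 => v _; case: ifP => _ //; rewrite subr_ge0.
Qed.
Local Hint Resolve product_law_ge0 : core.

Lemma Prob_le1 (A : config V -> Prop) : Prob mu A <= 1.
Proof.
rewrite ProbE -[leRHS](Expect_cst 1); apply: ler_Expect => // w.
by rewrite lern1 leq_b1.
Qed.

Lemma Prob_compl (A : config V -> Prop) : Prob mu (fun w => ~ A w) = 1 - Prob mu A.
Proof.
rewrite !ProbE -[X in X - _](Expect_cst 1) -ExpectB; apply: eq_Expect => w.
by rewrite asbool_neg; case: `[< A w >] => /=; ring.
Qed.

Lemma Prob_vacant U : Prob mu (fun w => forall v, v \in U -> ~~ w v) = (1 - p) ^+ #|U|.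
Proof.
rewrite ProbE (@eq_Expect _ _ _ _
    (fun w => \prod_v (if v \in U then (~~ w v)%:R else 1))).
  rewrite (@Expect_prod (fun v b => if v \in U then (~~ b)%:R else 1)).
  rewrite -prodr_const [RHS]big_mkcond; apply: eq_bigr => v _ /=.
  by case: ifP => _; ring.
move=> w; case: asboolP => [vac|].
  by rewrite big1 // => v _; case: ifP => // /vac ->.
move=> /existsNP[v /not_implyP[vU /negP/negbNE wv]].
by rewrite (bigD1 v) //= vU wv mul0r.
Qed.

Lemma Prob_vacant1 v : Prob mu (fun w => ~~ w v) = 1 - p.
Proof.
have := Prob_vacant [set v]; rewrite cards1 expr1 => <-.
rewrite !ProbE; apply: eq_Expect => w; congr (_%:R); congr (nat_of_bool _).
by apply/asboolP/asboolP => [wv u /set1P->//|]; apply; rewrite inE.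
Qed.

(* Exponential Markov inequality with base [1 / (p' a)]. *)
Lemma Prob_many_occupied U (p' a : R) (k : nat) : p <= p' -> 0 < p' -> 0 < a ->
  p' * a <= 1 -> #|U|%:R <= a ->
  Prob mu (fun w => (k <= #|[set v in U | w v]|)%N) <= expR 1 * (p' * a) ^+ k.
Proof.
move=> pp' p'0 a0 pa1 Ua; have /andP[p0 p1] := p01.
have pa0 : 0 < p' * a by rewrite mulr_gt0.
set Z := (p' * a)^-1; have Z1 : 1 <= Z by rewrite invf_ge1.
have Z0 : 0 <= Z := le_trans ler01 Z1.
rewrite [leRHS]mulrC.
apply: (@le_trans _ _ (E (fun w => (p' * a) ^+ k *
    \prod_v (if v \in U then (if w v then Z else 1) else 1)))).
  rewrite ProbE; apply: ler_Expect => // w.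
  have -> : \prod_v (if v \in U then if w v then Z else 1 else 1) =
      Z ^+ #|[set v in U | w v]|.
    rewrite -prodr_const [RHS]big_mkcond; apply: eq_bigr => v _ /=.
    by rewrite inE; case: (v \in U) => //=.
  case: asboolP => [kle|_]; last by rewrite mulr_ge0 // exprn_ge0 // ltW.
  rewrite -(subnKC kle) exprD mulrA -exprMn mulfV ?gt_eqF // expr1n mul1r.
  exact: exprn_ege1.
rewrite ExpectZ ler_pM2l ?exprn_gt0 //.
rewrite (@Expect_prod (fun v b => if v \in U then (if b then Z else 1) else 1)).
apply: (@le_trans _ _ (\prod_(v in U) expR (p' * Z))).
  rewrite [leRHS]big_mkcond; apply: ler_prod => v _ /=.
  case: ifP => _; last by apply/andP; split; lra.
  apply/andP; split; first by rewrite addr_ge0 ?mulr_ge0 ?subr_ge0.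
  apply: le_trans (expR_ge1Dx _); have := ler_wpM2r Z0 pp'; lra.
rewrite prodr_const -expRM_natl ler_expR.
have -> : p' * Z = a^-1 by rewrite /Z invfM mulrA mulfV ?gt_eqF // mul1r.
by rewrite ler_pdivrMr // mul1r.
Qed.

Definition depends_on U (h : config V -> R) :=
  forall w w', {in U, w =1 w'} -> h w = h w'.

(** Write the right side as a sum over two independent copies and let them exchange their bits
    outside U. This involution preserves the product weight, and after it both h and h' read the
    first copy. *)
Lemma Expect_indep U U' (h h' : config V -> R) : [disjoint U & U'] ->
  depends_on U h -> depends_on U' h' -> E (fun w => h w * h' w) = E h * E h'.
Proof.
move=> dUU' hU hU'.
pose mix w w' : config V := [ffun v => if v \in U then w v else w' v].
pose sw (x : config V * config V) := (mix x.1 x.2, mix x.2 x.1).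
have swK : involutive sw.
  move=> [w w']; rewrite /sw /=; congr pair; apply/ffunP => v;
  by rewrite !ffunE; case: (v \in U).
have musw x : mu (sw x).1 * mu (sw x).2 = mu x.1 * mu x.2.
  rewrite -!big_split /=; apply: eq_bigr => v _.
  by rewrite !ffunE; case: (v \in U) => //; rewrite mulrC.
have -> : E h * E h' = \sum_(x : config V * config V) (mu x.1 * h x.1) * (mu x.2 * h' x.2).
  by rewrite mulr_suml -(pair_bigA _ (fun w w' => mu w * h w * (mu w' * h' w'))) /=;
     apply: eq_bigr => w _; rewrite mulr_sumr.
rewrite (reindex_inj (inv_inj swK)) /=.
transitivity (\sum_(x : config V * config V) mu x.1 * (h x.1 * h' x.1) * mu x.2).
  rewrite -(pair_bigA _ (fun w w' => mu w * (h w * h' w) * mu w')) /=.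
  apply: eq_bigr => w _; rewrite -mulr_sumr -[LHS]mulr1; congr (_ * _).
  rewrite -[LHS](Expect_cst 1); apply: eq_bigr => w' _; by rewrite mulr1.
apply: eq_bigr => -[w w'] _ /=.
have -> : h (mix w w') = h w by apply: hU => v vU; rewrite ffunE vU.
have -> : h' (mix w' w) = h' w.
  by apply: hU' => v vU; rewrite ffunE; move: (disjointFl dUU' vU) => ->.
have /= m := musw (w, w').
transitivity ((mu w * mu w') * (h w * h' w)); first by ring.
by rewrite -m; ring.
Qed.

Lemma depends_onM U h h' : depends_on U h -> depends_on U h' ->
  depends_on U (fun w => h w * h' w).
Proof. by move=> hU hU' w w' ww'; rewrite (hU _ _ ww') (hU' _ _ ww'). Qed.

Lemma depends_onS U U' h : U \subset U' -> depends_on U h -> depends_on U' h.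
Proof. by move=> sUU' hU w w' ww'; apply: hU => v /(subsetP sUU'); exact: ww'. Qed.

Lemma Expect_indep_prod (J : finType) (U : J -> {set V}) (h : J -> config V -> R) :
  (forall i j, i != j -> [disjoint U i & U j]) ->
  (forall j, depends_on (U j) (h j)) ->
  E (fun w => \prod_j h j w) = \prod_j E (h j).
Proof.
move=> dU hU.
have prodE (F : J -> R) : \prod_j F j = \prod_(j <- enum J) F j by rewrite big_enum.
rewrite prodE (eq_Expect _ (fun w => prodE (h^~ w))).
elim: (enum J) (enum_uniq J) => [_|j s IHs /= /andP[js us]].
  by rewrite big_nil -[RHS](Expect_cst 1); apply: eq_Expect => w; rewrite big_nil.
rewrite big_cons -(IHs us).
have dep : depends_on (\bigcup_(i <- s) U i) (fun w => \prod_(i <- s) h i w).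
  elim: s {IHs js us} => [|i s IHs]; first by move=> w w' _; rewrite !big_nil.
  move=> w w' ww'; rewrite !big_cons; congr (_ * _).
    by apply: hU => v vU; apply: ww'; rewrite big_cons inE vU.
  by apply: IHs => v vU; apply: ww'; rewrite big_cons inE vU orbT.
have dis : [disjoint U j & \bigcup_(i <- s) U i].
  elim: s js {IHs us dep} => [|i s IHs]; first by rewrite big_nil -setI_eq0 setI0.
  rewrite inE negb_or big_cons => /andP[ji js].
  by rewrite -setI_eq0 setIUr setU_eq0 !setI_eq0 dU //= IHs.
rewrite -(Expect_indep dis (hU j) dep).
by apply: eq_Expect => w; rewrite big_cons.
Qed.

(** All bits have the same law. This is used with cyclic translations, which preserve the law on the
    box as well, although they do not preserve its adjacency. *)
Lemma Expect_perm (s : V -> V) (h : config V -> R) : injective s ->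
  E (fun w => h [ffun v => w (s v)]) = E h.
Proof.
move=> s_inj; have [t sK tK] := injF_bij s_inj.
rewrite [RHS](reindex (fun w : config V => [ffun v => w (s v)])) /=; last first.
  exists (fun w : config V => [ffun v => w (t v)]) => w _;
  by apply/ffunP => v; rewrite !ffunE ?sK ?tK.
apply: eq_bigr => w _; congr (_ * _).
rewrite /product_law (reindex_inj s_inj) /=.
by apply: eq_bigr => v _; rewrite ffunE.
Qed.

End ProductLaw.

(** * Biased Fourier analysis *)

Section BiasedFourier.
Variables (R : realType) (V : finType) (p : R).
Hypothesis p_gt0 : 0 < p.
Hypothesis p_lt1 : p < 1.
Implicit Types (w : config V) (S T U : {set V}) (f F G : config V -> R).
Local Notation mu := (product_law p).
Local Notation E := (Expect (@product_law R V p)).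

Let p01 : 0 <= p <= 1. Proof. by rewrite !ltW. Qed.
Let var_gt0 : 0 < p * (1 - p). Proof. by rewrite mulr_gt0 // subr_gt0. Qed.

(** The bit scaled to mean 0 and variance 1; products of these over a set are the biased Walsh
    characters [chi]. *)
Definition phi (b : bool) : R := (b%:R - p) / Num.sqrt (p * (1 - p)).

Let sd := Num.sqrt (p * (1 - p)).
Let sd_gt0 : 0 < sd. Proof. by rewrite sqrtr_gt0. Qed.
Let sdV2 : sd^-1 ^+ 2 * (p * (1 - p)) = 1.
Proof. by rewrite exprVn sqr_sqrtr ?(ltW var_gt0) // mulVf // gt_eqF. Qed.

Lemma phi_mean : p * phi true + (1 - p) * phi false = 0.
Proof. by rewrite /phi /=; ring. Qed.

Lemma phi_var : p * phi true ^+ 2 + (1 - p) * phi false ^+ 2 = 1.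
Proof.
rewrite /phi -/sd /=; transitivity (sd^-1 ^+ 2 * (p * (1 - p))); last exact: sdV2.
by ring.
Qed.

Lemma phi_true_false : phi true * phi false = -1.
Proof.
rewrite /phi -/sd /=; transitivity (- (sd^-1 ^+ 2 * (p * (1 - p)))).
  by ring.
by rewrite sdV2.
Qed.

Let D := (p * (1 - p))^-1.
Let sdD : sd^-1 ^+ 2 = D. Proof. by rewrite exprVn sqr_sqrtr // ltW. Qed.
Let DE : D * (p * (1 - p)) = 1. Proof. by rewrite mulVf // gt_eqF. Qed.
Let D_ge1 : 1 <= D.
Proof. by rewrite invf_ge1 //; nra. Qed.

Lemma phi_moment4 : p * phi true ^+ 4 + (1 - p) * phi false ^+ 4 <= D.
Proof.
have -> : p * phi true ^+ 4 + (1 - p) * phi false ^+ 4 =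
   D * (D * (p * (1 - p))) * ((1 - p) ^+ 3 + p ^+ 3).
  by rewrite /phi -/sd /= -sdD; ring.
rewrite DE mulr1 -[leRHS]mulr1 ler_pM2l; last by rewrite invr_gt0.
have -> : (1 - p) ^+ 3 + p ^+ 3 = 1 - 3 * (p * (1 - p)) by ring.
by have := var_gt0; lra.
Qed.

Lemma phi_moment3 : (p * phi true ^+ 3 + (1 - p) * phi false ^+ 3) ^+ 2 <= D.
Proof.
have -> : (p * phi true ^+ 3 + (1 - p) * phi false ^+ 3) ^+ 2 =
   D * (D * (p * (1 - p))) ^+ 2 * (1 - 2 * p) ^+ 2.
  by rewrite /phi -/sd /= -sdD; ring.
rewrite DE expr1n mulr1 -[leRHS]mulr1 ler_pM2l; last by rewrite invr_gt0.
have -> : (1 - 2 * p) ^+ 2 = 1 - 4 * (p * (1 - p)) by ring.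
by have := var_gt0; lra.
Qed.

Definition chi S w : R := \prod_v (if v \in S then phi (w v) else 1).

Lemma chi0 w : chi finset.set0 w = 1.
Proof. by rewrite /chi big1 // => v _; rewrite inE. Qed.

Lemma chiU1 v S w : v \notin S -> chi (v |: S) w = phi (w v) * chi S w.
Proof.
move=> vS; rewrite /chi (bigD1 v) //= [in RHS](bigD1 v) //= setU11 (negbTE vS) mul1r.
congr (_ * _); apply: eq_bigr => u uv.
by rewrite !inE (negbTE uv).
Qed.

(** The expectation factors over vertices. A vertex in both sets contributes the variance 1, a
    vertex in exactly one of them the mean 0. *)
Lemma chi_orthonormal S T : E (fun w => chi S w * chi T w) = (S == T)%:R.
Proof.
rewrite (@eq_Expect _ _ _ _ (fun w => \prod_v ((if v \in S then phi (w v) else 1) *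
  (if v \in T then phi (w v) else 1)))); last by move=> w; rewrite -big_split.
rewrite (@Expect_prod _ _ _ (fun v b => (if v \in S then phi b else 1) *
  (if v \in T then phi b else 1))).
have [<-|/eqP neqST] := eqVneq S T.
  by rewrite big1 // => v _; case: ifP => _; rewrite -?expr2 ?phi_var //; ring.
have [v /negP vST] : exists v, ~ (v \in S) == (v \in T).
  apply/existsNP => eqST; apply: neqST; apply/setP => v; exact/eqP/eqST.
rewrite (bigD1 v) //= [X in X * _](_ : _ = 0) ?mul0r //.
move: vST; case: (v \in S); case: (v \in T) => //= _; rewrite -[RHS]phi_mean; ring.
Qed.

Definition fhat f S := E (fun w => f w * chi S w).

(** Completeness of the characters. The sum over S is the expansion of a product of factors
    [phi (w v) * phi (w' v) + 1]; such a factor is the inverse weight of the bit when the two bits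
    agree, and 0 by [phi_true_false] when they differ. *)
Lemma chi_kernel w w' : mu w * \sum_S chi S w * chi S w' = (w == w')%:R.
Proof.
have -> : \sum_S chi S w * chi S w' = \prod_v (phi (w v) * phi (w' v) + 1).
  rewrite bigA_distr; apply: eq_bigr => S _; rewrite -big_split /=.
  by apply: eq_bigr => v _; case: ifP => _; rewrite ?mulr1.
rewrite -big_split /=; have [<-|neq] := eqVneq w w'.
  rewrite big1 // => v _; case: (w v) => /=; rewrite -expr2 /phi -/sd exprMn sdD /=.
    transitivity ((D * (p * (1 - p))) * (1 - p) + p); first by ring.
    by rewrite DE; ring.
  transitivity ((D * (p * (1 - p))) * p + (1 - p)); first by ring.
  by rewrite DE; ring.
have [v /eqP wv] : exists v, w v <> w' v.
  by apply/existsNP => eqww; case/eqP: neq; apply/ffunP.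
rewrite (bigD1 v) //= [X in _ * X * _](_ : _ = 0) ?mulr0 ?mul0r //.
move: wv; case: (w v); case: (w' v) => //= _; first by rewrite phi_true_false addNr.
by rewrite mulrC phi_true_false addNr.
Qed.

Lemma fourier_inversion f w : f w = \sum_S fhat f S * chi S w.
Proof.
have -> : \sum_S fhat f S * chi S w =
    \sum_w' f w' * (mu w' * \sum_S chi S w' * chi S w).
  rewrite /fhat /Expect; under eq_bigr do rewrite mulr_suml.
  rewrite exchange_big /=; apply: eq_bigr => w' _; rewrite !mulr_sumr.
  by apply: eq_bigr => S _; ring.
under eq_bigr do rewrite chi_kernel.
rewrite (bigD1 w) //= eqxx mulr1 big1 ?addr0 // => w' /negbTE ->.
by rewrite mulr0.
Qed.

Lemma Expect_fourier f G : E (fun w => G w * f w) = \sum_S fhat f S * fhat G S.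
Proof.
rewrite (@eq_Expect _ _ _ _ (fun w => \sum_S fhat f S * (G w * chi S w))).
  by rewrite Expect_sum; apply: eq_bigr => S _; rewrite ExpectZ.
move=> w; rewrite {1}(fourier_inversion f) mulr_sumr.
by apply: eq_bigr => S _; ring.
Qed.

Lemma Parseval f : E (fun w => f w ^+ 2) = \sum_S fhat f S ^+ 2.
Proof. exact: Expect_fourier. Qed.

(** Averaging over the fresh bit annihilates the factor of any resampled vertex of T, so each vertex
    of T contributes 1 - eps, the probability of not being resampled. *)
Lemma noise_chi (eps : R) F T :
  Expect (@noise_law R V p eps) (fun x : noise_sample V => F (omega x) * chi T (omega_eps x)) =
  (1 - eps) ^+ #|T| * fhat F T.
Proof.
rewrite /Expect.
transitivity (\sum_w \sum_s \sum_w' mu w * product_law eps s * mu w' *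
    (F w * chi T [ffun v => if s v then w' v else w v])).
  rewrite pair_bigA /= pair_bigA /=.
  by apply: eq_bigr => -[[w s] w'] _.
rewrite [RHS]mulr_sumr; apply: eq_bigr => w _.
transitivity (mu w * F w * Expect (product_law eps) (fun s =>
    E (fun w' => chi T [ffun v => if s v then w' v else w v]))).
  rewrite /Expect mulr_sumr; apply: eq_bigr => s _; rewrite !mulr_sumr.
  by apply: eq_bigr => w' _; ring.
rewrite (@eq_Expect _ _ _ _ (fun s : config V => \prod_v (if v \in T then (if s v then 0 else phi (w v)) else 1))); last first.
  move=> s; rewrite (@eq_Expect _ _ _ _ (fun w' : config V => \prod_v (if v \in T then (if s v then phi (w' v) else phi (w v)) else 1))); last first.
    by move=> w'; apply: eq_bigr => v _; rewrite ffunE; case: (s v).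
  rewrite (@Expect_prod _ _ _ (fun v b => if v \in T then if s v then phi b else phi (w v) else 1)).
  apply: eq_bigr => v _; case: ifP => _; last by ring.
  by case: ifP => _; [exact: phi_mean | ring].
rewrite (@Expect_prod _ _ _ (fun v b => if v \in T then if b then 0 else phi (w v) else 1)).
rewrite -mulrA [RHS]mulrCA; congr (_ * _); rewrite [RHS]mulrCA; congr (_ * _).
rewrite /chi -prodr_const [X in _ = X * _]big_mkcond -big_split /=; apply: eq_bigr => v _.
by case: ifP => _; ring.
Qed.

Lemma noise_fourier (eps : R) F G :
  Expect (@noise_law R V p eps) (fun x : noise_sample V => F (omega x) * G (omega_eps x)) =
  \sum_(T : {set V}) (1 - eps) ^+ #|T| * (fhat F T * fhat G T).
Proof.
rewrite (@eq_Expect _ _ _ _ (fun x : noise_sample V =>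
    \sum_T fhat G T * (F (omega x) * chi T (omega_eps x)))).
  rewrite Expect_sum; apply: eq_bigr => T _; rewrite ExpectZ noise_chi.
  by ring.
move=> x; rewrite {1}(fourier_inversion G) mulr_sumr.
by apply: eq_bigr => T _; ring.
Qed.

Lemma chi_depends S : depends_on S (chi S).
Proof. by move=> w w' ww'; apply: eq_bigr => v _; case: ifP => // /ww' ->. Qed.

(** The factor [phi (w v)] has mean 0 and is independent of everything else in the product. *)
Lemma fhat_depends f v S : v \in S -> depends_on (~: [set v]) f -> fhat f S = 0.
Proof.
move=> vS fdep; rewrite /fhat -(setD1K vS).
rewrite (@eq_Expect _ _ _ _ (fun w => phi (w v) * (f w * chi (S :\ v) w))); last first.
  by move=> w; rewrite chiU1 ?setD11 //; ring.
rewrite (@Expect_indep _ _ p [set v] (~: [set v]) (fun w => phi (w v))).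
- rewrite (_ : E _ = 0) ?mul0r //.
  rewrite (@eq_Expect _ _ _ _ (chi [set v])).
    by have := chi_orthonormal [set v] finset.set0; under eq_Expect do rewrite chi0 mulr1;
       move=> ->; rewrite -cards_eq0 cards1.
  by move=> w; rewrite -[finset.set1 v]setU0 chiU1 ?inE // chi0 mulr1.
- by rewrite -setI_eq0 setICr.
- by move=> w w' ->; rewrite ?inE.
- apply: depends_onM => //; apply: depends_onS (@chi_depends _).
  by rewrite finset.setDE finset.subsetIr.
Qed.

(** The restriction to subsets of U makes an induction on U possible, one vertex at a time. *)
Definition fourier_sum U (c : {set V} -> R) w := \sum_(S : {set V} | S \subset U) c S * chi S w.

Lemma fourier_sum_depends U c : depends_on U (fourier_sum U c).
Proof.
move=> w w' ww'; apply: eq_bigr => S sSU; congr (_ * _).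
by apply: chi_depends => v /(subsetP sSU); exact: ww'.
Qed.

Lemma fourier_sumU1 v U c w : v \notin U ->
  fourier_sum (v |: U) c w =
  fourier_sum U c w + phi (w v) * fourier_sum U (fun S => c (v |: S)) w.
Proof.
move=> vU; rewrite /fourier_sum (bigID (fun S : {set V} => v \in S)) /= addrC; congr (_ + _).
  apply: eq_bigl => S; apply/andP/idP => [[sS vS]|sS].
    apply/subsetP => u uS; have := subsetP sS _ uS; rewrite !inE => /predU1P[uv|//].
    by rewrite -uv uS in vS.
  split; first by rewrite (subset_trans sS) // subsetUr.
  by apply: contra vU; apply: subsetP.
rewrite mulr_sumr (reindex_onto (fun S => v |: S) (fun S => S :\ v)) /=; last first.
  by move=> S /andP[_ vS]; rewrite setD1K.
apply: eq_big => [S|S /andP[/andP[_ _] /eqP eS]].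
  apply/andP/idP => [[/andP[sS _] /eqP eS]|sS].
    apply/subsetP => u uS; have vS : u != v by apply: contraL uS => /eqP ->; rewrite -eS setD11.
    by have := subsetP sS u; rewrite !inE uS (negbTE vS) /= => ->.
  by rewrite setUS // setU11; split=> //; rewrite setU1K //; apply: contra vU; apply: subsetP.
rewrite chiU1; first by ring.
by rewrite -eS setD11.
Qed.

Lemma Expect_coord v U (g : bool -> R) h : v \notin U -> depends_on U h ->
  E (fun w => g (w v) * h w) = (p * g true + (1 - p) * g false) * E h.
Proof.
move=> vU hU; rewrite (@Expect_indep _ _ p [set v] U (fun w => g (w v))) //.
- congr (_ * _).
  rewrite (@eq_Expect _ _ _ _ (fun w => \prod_u (if u == v then g (w u) else 1))).
    rewrite (@Expect_prod _ _ _ (fun u b => if u == v then g b else 1)).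
    rewrite (bigD1 v) //= eqxx big1 ?mulr1 // => u /negbTE ->; ring.
  by move=> w; rewrite (bigD1 v) //= eqxx big1 ?mulr1 // => u /negbTE ->.
- by rewrite disjoints1.
- by move=> w w' ->; rewrite ?inE.
Qed.

(** Induction on the size of U. Removing a vertex v writes the sum as a + phi b, where a and b do
    not read the bit at v and b has degree at most K - 1. Expanding the fourth power and bounding
    the third and fourth moments of phi by D leaves E a^4 + 8 E a^2 b^2 + 3 D E b^4, and the
    induction hypotheses for a and b are combined by Cauchy-Schwarz. *)
Lemma biased_bonami (U : {set V}) c (K : nat) :
  (forall S, S \subset U -> c S != 0 -> (#|S| <= K)%N) ->
  E (fun w => fourier_sum U c w ^+ 4) <=
    (16 * D) ^+ K * E (fun w => fourier_sum U c w ^+ 2) ^+ 2.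
Proof.
set B := 16 * D.
have B_ge16 : 16 <= B by rewrite -[leLHS]mulr1 ler_pM2l // ltr0n.
have B_gt0 : 0 < B by apply: lt_le_trans B_ge16; rewrite ltr0n.
have [n] := ubnP #|U|; elim: n U c K => // n IHn U c K /ltnSE leUn cK.
have [U0|[v vU]] := set_0Vmem U.
  have fE w : fourier_sum U c w = c finset.set0.
    rewrite /fourier_sum (bigD1 finset.set0) /= ?sub0set // chi0 mulr1 big1 ?addr0 // => S.
    by rewrite U0 subset0 => /andP[/eqP ->]; rewrite eqxx.
  under eq_Expect do rewrite fE; under [X in _ * X ^+ 2]eq_Expect do rewrite fE.
  rewrite !Expect_cst -exprM -[leLHS]mul1r ler_wpM2r //.
    exact: exprn_even_ge0.
  by apply: exprn_ege1; apply: le_trans B_ge16; rewrite ler1n.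
set U' := U :\ v; have vU' : v \notin U' by rewrite setD11.
have UE : U = v |: U' by rewrite setD1K.
have cardU' : (#|U'| < n)%N by move: leUn; rewrite (cardsD1 v) vU.
pose a := fourier_sum U' c; pose c' S := c (v |: S); pose b := fourier_sum U' c'.
have aU : depends_on U' a by exact: fourier_sum_depends.
have bU : depends_on U' b by exact: fourier_sum_depends.
have fE w : fourier_sum U c w = a w + phi (w v) * b w by rewrite UE fourier_sumU1.
have mom k h : depends_on U' h -> E (fun w => phi (w v) ^+ k * h w) =
    (p * phi true ^+ k + (1 - p) * phi false ^+ k) * E h.
  by move=> hU; exact: (@Expect_coord v U' (fun b => phi b ^+ k)).
have dX (h : config V -> R) k : depends_on U' h -> depends_on U' (fun w => h w ^+ k).
  by move=> hU w w' /hU ->.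
have E2 : E (fun w => fourier_sum U c w ^+ 2) = E (fun w => a w ^+ 2) + E (fun w => b w ^+ 2).
  transitivity (E (fun w => a w ^+ 2 + (2 * (phi (w v) ^+ 1 * (a w * b w)) + phi (w v) ^+ 2 * b w ^+ 2))).
    by apply: eq_Expect => w; rewrite fE; ring.
  rewrite !ExpectD ExpectZ (mom 1%N _ (depends_onM aU bU)) (mom 2%N _ (dX _ 2%N bU)).
  by rewrite !expr1 phi_mean phi_var; ring.
have E4 : E (fun w => fourier_sum U c w ^+ 4) <= E (fun w => a w ^+ 4) +
    8 * E (fun w => a w ^+ 2 * b w ^+ 2) + 3 * D * E (fun w => b w ^+ 4).
  set k3 := p * phi true ^+ 3 + (1 - p) * phi false ^+ 3.
  set k4 := p * phi true ^+ 4 + (1 - p) * phi false ^+ 4.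
  have -> : E (fun w => fourier_sum U c w ^+ 4) = E (fun w => a w ^+ 4 +
      (6 * (a w ^+ 2 * b w ^+ 2) + (4 * k3 * (a w * b w ^+ 3) + k4 * b w ^+ 4))).
    transitivity (E (fun w => a w ^+ 4 + (4 * (phi (w v) ^+ 1 * (a w ^+ 3 * b w)) +
      (6 * (phi (w v) ^+ 2 * (a w ^+ 2 * b w ^+ 2)) +
      (4 * (phi (w v) ^+ 3 * (a w * b w ^+ 3)) + phi (w v) ^+ 4 * b w ^+ 4))))).
      by apply: eq_Expect => w; rewrite fE; ring.
    rewrite !ExpectD !ExpectZ (mom 1%N _ (depends_onM (dX _ 3%N aU) bU)).
    rewrite (mom 2%N _ (depends_onM (dX _ 2%N aU) (dX _ 2%N bU))).
    rewrite (mom 3%N _ (depends_onM aU (dX _ 3%N bU))) (mom 4%N _ (dX _ 4%N bU)).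
    by rewrite !expr1 phi_mean phi_var -/k3 -/k4; ring.
  rewrite -!ExpectZ -!ExpectD; apply: ler_Expect => [w|w]; first exact: product_law_ge0.
  rewrite -!addrA lerD2l.
  have k3D : k3 ^+ 2 <= D := phi_moment3.
  have k4D : k4 <= D := phi_moment4.
  have b4 : 0 <= b w ^+ 4 by rewrite exprn_even_ge0.
  (* This square absorbs the cross term 4 k3 a b^3, whose sign is unknown, at the price of 2 a^2 b^2
     + 2 k3^2 b^4. *)
  have q : 0 <= 2 * (a w * b w - k3 * b w ^+ 2) ^+ 2 by rewrite mulr_ge0 // sqr_ge0.
  have h3 : k3 ^+ 2 * b w ^+ 4 <= D * b w ^+ 4 by rewrite ler_wpM2r.
  have h4 : k4 * b w ^+ 4 <= D * b w ^+ 4 by rewrite ler_wpM2r.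
  rewrite -subr_ge0 in h3; rewrite -subr_ge0 in h4.
  rewrite -subr_ge0; apply: (@le_trans _ _ (2 * (a w * b w - k3 * b w ^+ 2) ^+ 2 +
    2 * (D * b w ^+ 4 - k3 ^+ 2 * b w ^+ 4) + (D * b w ^+ 4 - k4 * b w ^+ 4))).
    by apply: addr_ge0 => //; apply: addr_ge0 => //; apply: mulr_ge0.
  by rewrite le_eqVlt; apply/orP; left; apply/eqP; ring.
have subU' S : S \subset U' -> S \subset U.
  by move=> sS; rewrite (subset_trans sS) // subsetDl.
have Ia : E (fun w => a w ^+ 4) <= B ^+ K * E (fun w => a w ^+ 2) ^+ 2.
  by apply: IHn => // S /subU'; exact: cK.
set ea := E (fun w => a w ^+ 2) in E2 Ia *; set eb := E (fun w => b w ^+ 2) in E2 *.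
have ge0 k : forall X : config V -> R, 0 <= E (fun w => X w ^+ (2 * k)).
  move=> X; apply: Expect_ge0 => w; first exact: product_law_ge0.
  by rewrite exprM exprn_ge0 // sqr_ge0.
have ea0 : 0 <= ea by exact: (ge0 1%N).
have eb0 : 0 <= eb by exact: (ge0 1%N).
have a40 : 0 <= E (fun w => a w ^+ 4) by exact: (ge0 2%N).
have b40 : 0 <= E (fun w => b w ^+ 4) by exact: (ge0 2%N).
(* The lower degree of b gains a factor B. For K = 0 no set containing v has a nonzero coefficient,
   so b vanishes. *)
have Ib : B * E (fun w => b w ^+ 4) <= B ^+ K * eb ^+ 2.
  case: K cK {Ia} => [cK|K cK].
    have b0 w : b w = 0.
      rewrite /b /fourier_sum big1 // => S sS; apply/eqP; rewrite mulf_eq0; apply/orP; left.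
      have sSU : v |: S \subset U by rewrite UE setUS.
      by apply/negPn/negP => /(cK _ sSU); rewrite leqn0 cards_eq0 => /eqP/setP/(_ v); rewrite !inE eqxx.
    rewrite /eb; under [X in _ * X <= _]eq_Expect do rewrite b0.
    under [X in _ <= _ * X ^+ 2]eq_Expect do rewrite b0.
    by rewrite !expr0n /= !Expect_cst expr0n /= !mulr0.
  rewrite exprS -mulrA ler_pM2l //; apply: IHn => // S sS c'S.
  have sSU : v |: S \subset U by rewrite UE setUS.
  have := cK _ sSU c'S; rewrite cardsU1 (_ : v \notin S) //.
  by apply: contra vU'; apply: subsetP.
have BK0 : 0 <= B ^+ K by rewrite exprn_ge0 // ltW.
have Iab : 4 * E (fun w => a w ^+ 2 * b w ^+ 2) <= B ^+ K * (ea * eb).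
  set m := E _; have m0 : 0 <= m.
    apply: Expect_ge0 => w; first exact: product_law_ge0.
    by rewrite mulr_ge0 // sqr_ge0.
  have BKe : 0 <= B ^+ K * (ea * eb) by rewrite !mulr_ge0.
  rewrite -ler_sqr ?nnegrE ?mulr_ge0 // exprMn.
  have CS : m ^+ 2 <= E (fun w => a w ^+ 4) * E (fun w => b w ^+ 4).
    rewrite /m; under [X in _ <= X * _]eq_Expect do rewrite (_ : 4 = 2 * 2)%N // exprM.
    under [X in _ <= _ * X]eq_Expect do rewrite (_ : 4 = 2 * 2)%N // exprM.
    by apply: Expect_CS => w; exact: product_law_ge0.
  (* The constant 16 in B is what turns 4^2 into B; the factor B is then spent in [Ib]. *)
  apply: (@le_trans _ _ (B * (E (fun w => a w ^+ 4) * E (fun w => b w ^+ 4)))).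
    rewrite (_ : 4 ^+ 2 = 16) -?natrX //; apply: ler_pM => //; exact: sqr_ge0.
  rewrite mulrCA (_ : (B ^+ K * (ea * eb)) ^+ 2 = (B ^+ K * ea ^+ 2) * (B ^+ K * eb ^+ 2)); last by ring.
  by apply: ler_pM => //; rewrite mulr_ge0 // ltW.
apply: le_trans E4 _; rewrite E2.
have Db : 3 * D * E (fun w => b w ^+ 4) <= B ^+ K * eb ^+ 2.
  apply: le_trans Ib; rewrite /B -!mulrA.
  have := mulr_ge0 (le_trans ler01 D_ge1) b40; lra.
set x := E (fun w => a w ^+ 4) in Ia *; set y := E (fun w => _ * _) in Iab *.
set z := 3 * D * _ in Db *.
have -> : B ^+ K * (ea + eb) ^+ 2 = B ^+ K * ea ^+ 2 + 2 * (B ^+ K * (ea * eb)) + B ^+ K * eb ^+ 2.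
  by ring.
move: (B ^+ K * ea ^+ 2) (B ^+ K * (ea * eb)) (B ^+ K * eb ^+ 2) Ia Iab Db => A1 A2 A3 *.
by have := var_gt0; lra.
Qed.

Lemma Expect_fourier_sum F U c :
  E (fun w => F w * fourier_sum U c w) = \sum_(S : {set V} | S \subset U) c S * fhat F S.
Proof.
rewrite (@eq_Expect _ _ _ _
  (fun w => \sum_(S : {set V} | S \subset U) c S * (F w * chi S w))).
  by rewrite Expect_sum; apply: eq_bigr => S _; rewrite ExpectZ.
by move=> w; rewrite mulr_sumr; apply: eq_bigr => S _; ring.
Qed.

(** The event [f w <> f (vacate v w)] says that v is occupied and pivotal; its probability plays the
    role of the influence of v. *)
Definition vacate v w : config V := [ffun u => (u != v) && w u].

(** Let G be the part of f on the sets counted in the sum X, so that X = E G^2. As [f0] does not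
    read v, it is orthogonal to G and X = E (f - f0) G. The difference f - f0 has modulus at most 2
    and lives on an event of probability P. Cauchy-Schwarz gives X^2 <= 4 P m with m the integral of
    G^2 over that event; a second application with [biased_bonami] gives m^2 <= P B^K X^2, where B =
    16 D. Then X^2 cancels. *)
Lemma low_degree_weight f v (K : nat) :
  (forall w, f w = 1 \/ f w = -1) ->
  (\sum_(S : {set V} | (v \in S) && (#|S| <= K)%N) fhat f S ^+ 2) ^+ 2 <=
  16 * Prob mu (fun w => f w <> f (vacate v w)) ^+ 3 * (16 * D) ^+ K.
Proof.
move=> f1; set X := \sum_(S | _) _; set P := Prob _ _.
have mu0 w : 0 <= mu w by exact: product_law_ge0.
pose c (S : {set V}) := if (v \in S) && (#|S| <= K)%N then fhat f S else 0.
pose G := fourier_sum [set: V] c.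
have EG F : E (fun w => F w * G w) = \sum_(S : {set V}) c S * fhat F S.
  by rewrite Expect_fourier_sum; apply: eq_bigl => S; rewrite finset.subsetT.
have fG S : fhat G S = c S.
  rewrite /fhat (@eq_Expect _ _ _ _ (fun w => chi S w * G w)); last by move=> w; rewrite mulrC.
  rewrite EG (bigD1 S) //= {1}/fhat chi_orthonormal eqxx mulr1 big1 ?addr0 // => T TS.
  by rewrite /fhat chi_orthonormal eq_sym (negbTE TS) mulr0.
have X0 : 0 <= X by apply: sumr_ge0 => S _; exact: sqr_ge0.
have G2 : E (fun w => G w ^+ 2) = X.
  rewrite [LHS]EG /X [RHS]big_mkcond; apply: eq_bigr => S _.
  by rewrite fG /c; case: ifP => _; rewrite ?expr2 ?mul0r.
have G4 : E (fun w => G w ^+ 4) <= (16 * D) ^+ K * X ^+ 2.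
  rewrite -G2; apply: biased_bonami => S _.
  by rewrite /c; case: ifP => [/andP[_ ->]//|]; rewrite eqxx.
pose f0 w := f (vacate v w).
have f0dep : depends_on (~: [set v]) f0.
  move=> w w' ww'; congr f; apply/ffunP => u; rewrite !ffunE.
  by case: eqVneq => //= uv; apply: ww'; rewrite !inE.
have XE : X = E (fun w => (f w - f0 w) * G w).
  rewrite (@eq_Expect _ _ _ _ (fun w => f w * G w - f0 w * G w)); last by move=> w; ring.
  rewrite ExpectB !EG [X in _ - X]big1 ?subr0.
    rewrite /X big_mkcond; apply: eq_bigr => S _.
    by rewrite /c; case: ifP => _; rewrite ?expr2 ?mul0r.
  move=> S _; rewrite /c; case: ifP => [/andP[vS _]|_]; last by rewrite mul0r.
  by rewrite (fhat_depends vS f0dep) mulr0.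
pose I w : R := (`[< f w <> f0 w >])%:R.
have PE : P = E I by rewrite /P ProbE.
have I2 w : I w ^+ 2 = I w by rewrite /I; case: `[< _ >]; rewrite ?expr1n ?expr0n.
have P0 : 0 <= P by exact: Prob_ge0.
set m := E (fun w => I w * G w ^+ 2).
have m0 : 0 <= m.
  by apply: Expect_ge0 => // w; rewrite mulr_ge0 ?sqr_ge0 // ler0n.
have Xm : X ^+ 2 <= 4 * P * m.
  rewrite {1}XE (@eq_Expect _ _ _ _ (fun w => I w * ((f w - f0 w) * G w))); last first.
    move=> w; rewrite /I; case: asboolP => [_|/contrapT ->]; first by rewrite mul1r.
    by rewrite subrr !mul0r.
  apply: le_trans (Expect_CS mu0 _ _) _.
  under [X in X * _ <= _]eq_Expect do rewrite I2.
  rewrite -PE [leRHS](_ : _ = P * (4 * m)); last by ring.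
  rewrite ler_wpM2l // /m -ExpectZ; apply: ler_Expect => // w.
  rewrite exprMn mulrA ler_wpM2r ?sqr_ge0 // /I.
  case: asboolP => [_|/contrapT ->]; last by rewrite subrr expr0n mulr0.
  rewrite mulr1 /f0.
  by case: (f1 w) => ->; case: (f1 (vacate v w)) => ->; lra.
have mX : m ^+ 2 <= P * ((16 * D) ^+ K * X ^+ 2).
  apply: le_trans (Expect_CS mu0 _ _) _.
  under [X in X * _ <= _]eq_Expect do rewrite I2.
  rewrite -PE ler_wpM2l //; apply: le_trans G4.
  by apply: ler_Expect => // w; rewrite -exprM.
have [->|Xn0] := eqVneq X 0.
  rewrite expr0n /= !mulr_ge0 // ?exprn_ge0 // mulr_ge0 //.
  exact: le_trans ler01 D_ge1.
have X2 : 0 < X ^+ 2 by rewrite exprn_gt0 // lt0r Xn0.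
rewrite -(ler_pM2r X2).
apply: (@le_trans _ _ ((4 * P * m) ^+ 2)).
  by rewrite -expr2 ler_sqr ?nnegrE ?sqr_ge0 // !mulr_ge0.
rewrite exprMn [leRHS](_ : _ = (4 * P) ^+ 2 * (P * ((16 * D) ^+ K * X ^+ 2))); last by ring.
by rewrite ler_wpM2l // sqr_ge0.
Qed.

(** A centred function with values 1 and -1 has variance 1, so the correlation is the sum of (1 -
    eps)^|T| times the squared coefficients. A nonempty T of size at most K is counted at one of its
    vertices, with weight at most y per vertex; the larger sets have total weight at most 1 by
    Parseval. *)
Lemma noise_corr_bound f (eps a y : R) (K : nat) :
  (forall w, f w = 1 \/ f w = -1) -> E f = 0 -> 0 <= eps <= 1 ->
  0 <= y -> (forall v, Prob mu (fun w => f w <> f (vacate v w)) <= a) ->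
  16 * a ^+ 3 * (16 * D) ^+ K <= y ^+ 2 ->
  `|noise_corr p eps f| <= #|V|%:R * y + (1 - eps) ^+ K.
Proof.
move=> f1 Ef /andP[e0 e1] y0 fa ay.
have mu0 w : 0 <= mu w by exact: product_law_ge0.
have fhat0 : fhat f finset.set0 = 0.
  by rewrite -[RHS]Ef; apply: eq_Expect => w; rewrite chi0 mulr1.
have f2 w : f w * f w = 1 by case: (f1 w) => ->; ring.
have fhat1 T : fhat (fun=> 1) T = (T == finset.set0)%:R.
  rewrite -(chi_orthonormal T finset.set0); apply: eq_Expect => w.
  by rewrite chi0 mulr1 mul1r.
have En1 : Expect (@noise_law R V p eps) (fun=> 1) = 1 :> R.
  rewrite (@eq_Expect _ _ _ _ (fun x : noise_sample V => 1 * chi finset.set0 (omega_eps x))).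
    by rewrite (noise_chi eps (fun=> 1)) cards0 expr0 mul1r fhat1 eqxx.
  by move=> x; rewrite chi0 mulr1.
have Eom : Expect (@noise_law R V p eps) (fun x : noise_sample V => f (omega x)) = 0.
  rewrite (@eq_Expect _ _ _ _ (fun x : noise_sample V => f (omega x) * chi finset.set0 (omega_eps x))).
    by rewrite noise_chi fhat0 mulr0.
  by move=> x; rewrite chi0 mulr1.
have Eoe : Expect (@noise_law R V p eps) (fun x : noise_sample V => f (omega_eps x)) = 0.
  rewrite (@eq_Expect _ _ _ _ (fun x : noise_sample V => (fun=> 1) (omega x) * f (omega_eps x))).
    rewrite (noise_fourier eps (fun=> 1) f) big1 // => T _.
    by rewrite fhat1; case: eqVneq => [->|_]; rewrite ?fhat0 ?mul0r ?mulr0.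
  by move=> x; rewrite mul1r.
have CovE : noise_corr p eps f = \sum_(T : {set V}) (1 - eps) ^+ #|T| * fhat f T ^+ 2.
  rewrite /noise_corr /Corr /Var /Cov Eom Eoe.
  have one (g : noise_sample V -> config V) :
      Expect (@noise_law R V p eps) (fun x => (f (g x) - 0) * (f (g x) - 0)) = 1.
    by rewrite -[RHS]En1; apply: eq_Expect => x; rewrite subr0 f2.
  rewrite !one mulr1 sqrtr1 divr1.
  under eq_Expect do rewrite !subr0.
  by rewrite noise_fourier; apply: eq_bigr => T _; rewrite expr2.
have e01 : 0 <= 1 - eps by rewrite subr_ge0.
have e1' : 1 - eps <= 1 by rewrite lerBlDr lerDl.
rewrite CovE ger0_norm; last first.
  by apply: sumr_ge0 => T _; rewrite mulr_ge0 ?sqr_ge0 // exprn_ge0.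
pose X v := \sum_(S : {set V} | (v \in S) && (#|S| <= K)%N) fhat f S ^+ 2.
have Xy v : X v <= y.
  rewrite -ler_sqr ?nnegrE //; last by apply: sumr_ge0 => S _; exact: sqr_ge0.
  apply: le_trans (low_degree_weight v K f1) _; apply: le_trans ay.
  rewrite ler_wpM2r //.
    by rewrite exprn_ge0 // mulr_ge0 // (le_trans ler01).
  have P0 : 0 <= Prob mu (fun w => f w <> f (vacate v w)) by exact: Prob_ge0.
  by rewrite ler_wpM2l // lerXn2r ?nnegrE ?fa // (le_trans P0).
have -> : (1 - eps) ^+ K = \sum_(T : {set V}) (1 - eps) ^+ K * fhat f T ^+ 2.
  rewrite -mulr_sumr -Parseval; under eq_Expect do rewrite expr2 f2.
  by rewrite Expect_cst mulr1.
apply: (@le_trans _ _ (\sum_v X v + \sum_(T : {set V}) (1 - eps) ^+ K * fhat f T ^+ 2)).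
  rewrite /X; under [X in _ <= X + _]eq_bigr do rewrite big_mkcond.
  rewrite exchange_big -big_split /=; apply: ler_sum => T _.
  have t0 : 0 <= fhat f T ^+ 2 by exact: sqr_ge0.
  have [leTK|ltKT] := leqP #|T| K; last first.
    rewrite big1 ?add0r; last by move=> v _; rewrite andbF.
    rewrite ler_wpM2r // -(subnKC (ltnW ltKT)) exprD ler_piMr ?exprn_ge0 //.
    exact: exprn_ile1.
  have [->|[v vT]] := set_0Vmem T.
    rewrite fhat0 expr0n !mulr0 addr0 big1 // => v _.
    by rewrite inE.
  rewrite (bigD1 v) //= vT -addrA -[leLHS]addr0 lerD //.
    by rewrite ler_piMl // exprn_ile1.
  apply: addr_ge0; last by apply: mulr_ge0 => //; exact: exprn_ge0.
  by apply: sumr_ge0 => u _; case: ifP.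
rewrite lerD2r mulr_natl -sumr_const; exact: ler_sum.
Qed.

End BiasedFourier.

(** * Generated sets *)

Section Generation.
Variables (V : finType) (e : rel V).
Hypothesis e_sym : symmetric e.
Implicit Types (w : config V) (C X : {set V}).

Definition occ w : {set V} := [set v | `[< exists t, v \in occupied_at e 2 w t >]].

Lemma occP w v : reflect (exists t, v \in occupied_at e 2 w t) (v \in occ w).
Proof. by rewrite inE; apply: asboolP. Qed.

Lemma complete_occ w : complete_occupation e 2 w <-> occ w = [set: V].
Proof.
split=> [cw|ow v]; first apply/setP => v.
  by rewrite [RHS]inE; apply/occP/cw.
by apply/occP; rewrite ow inE.
Qed.

Lemma occupied_at_mono w t t' : (t <= t')%N -> occupied_at e 2 w t \subset occupied_at e 2 w t'.
Proof.
move=> /subnK <-; elim: (t' - t)%N => // k IHk.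
by rewrite addSn /=; apply: (subset_trans IHk); apply: subsetUl.
Qed.

Lemma occ_seed w v : w v -> v \in occ w.
Proof. by move=> wv; apply/occP; exists 0%N; rewrite inE. Qed.

Lemma occ_infect w u u' v : u != u' -> u \in occ w -> u' \in occ w ->
  e v u -> e v u' -> v \in occ w.
Proof.
move=> uu' /occP[t ut] /occP[t' ut'] vu vu'; apply/occP; exists (maxn t t').+1.
have {}ut := subsetP (occupied_at_mono w (leq_maxl t t')) _ ut.
have {}ut' := subsetP (occupied_at_mono w (leq_maxr t t')) _ ut'.
rewrite /= inE; apply/orP; right; rewrite inE.
have card2 : #|[set u; u']| = 2%N by rewrite cards2 uu'.
rewrite -[X in (X <= _)%N]card2; apply: subset_leq_card; apply/subsetP.
by move=> x /set2P[] ->; rewrite inE; apply/andP.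
Qed.

Lemma occ_ind w (P : V -> Prop) : (forall v, w v -> P v) ->
  (forall u u' v, u != u' -> P u -> P u' -> e v u -> e v u' -> P v) ->
  forall v, v \in occ w -> P v.
Proof.
move=> Pw Pe v /occP[t]; elim: t v => [|t IHt] v; first by rewrite inE => /Pw.
rewrite /= inE => /orP[/IHt//|]; rewrite inE => /card_gt1P[u [u' [uA u'A uu']]].
move: uA u'A; rewrite !inE => /andP[/IHt Pu vu] /andP[/IHt Pu' vu'].
exact: Pe uu' Pu Pu' vu vu'.
Qed.

(** Connectedness in the form of an induction principle: a property that holds at one point of C and
    propagates along the edges inside C holds on all of C. *)
Definition conn C := forall X x, x \in C -> x \in X ->
  (forall u v, u \in X -> u \in C -> v \in C -> e u v -> v \in X) -> C \subset X.

Lemma conn1 v : conn [set v].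
Proof. by move=> X x /set1P -> vX _; rewrite sub1set. Qed.

Lemma connU C C' u v : conn C -> conn C' -> u \in C -> v \in C' -> e u v -> conn (C :|: C').
Proof.
move=> cC cC' uC vC' uv X x xCC' xX clX.
have half A B a b : conn A -> conn B -> (forall z, z \in A -> z \in C :|: C') ->
    (forall z, z \in B -> z \in C :|: C') -> a \in A -> b \in B -> e a b -> x \in A ->
    (A \subset X) && (B \subset X).
  move=> cA cB sA sB aA bB ab xA.
  have AX : A \subset X by apply: (cA X x) => // y z yX /sA yA /sA zA; exact: clX.
  rewrite AX; apply: (cB X b) => //.
    by apply: (clX a) => //; [exact: (subsetP AX)|exact: sA|exact: sB].
  by move=> y z yX /sB yB /sB zB; exact: clX.
have sC z : z \in C -> z \in C :|: C' by rewrite inE => ->.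
have sC' z : z \in C' -> z \in C :|: C' by rewrite inE orbC => ->.
case/setUP: (xCC') => [xC|xC']; rewrite subUset.
  exact: (half _ _ u v).
by rewrite andbC; apply: (half _ _ v u) => //; rewrite e_sym.
Qed.

(** These are sets filled by their own occupied vertices. The two sets joined in a step may overlap
    or coincide, so one set can also be enlarged by a vertex it infects. *)
Inductive gen w : {set V} -> Prop :=
| gen_seed v : w v -> gen w [set v]
| gen_merge C C' u v : gen w C -> gen w C' -> u \in C -> v \in C' -> e u v ->
    gen w (C :|: C')
| gen_infect C C' u u' v : gen w C -> gen w C' -> u \in C -> u' \in C' -> u != u' ->
    e v u -> e v u' -> gen w (v |: (C :|: C')).

Lemma gen_nonempty w C : gen w C -> exists v, v \in C.
Proof.
case=> [v _|? ? u v _ _ uC _ _|? ? ? ? v _ _ _ _ _ _ _].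
- by exists v; rewrite inE.
- by exists u; rewrite inE uC.
- by exists v; rewrite !inE eqxx.
Qed.

Lemma gen_conn w C : gen w C -> conn C.
Proof.
elim=> {C} [v _|C C' u v _ cC _ cC' uC vC' uv|C C' u u' v _ cC _ cC' uC uC' _ vu vu'].
- exact: conn1.
- exact: connU uC vC' uv.
- rewrite setUA; apply: (@connU _ _ v u') => //; last by rewrite !inE eqxx.
  by apply: (@connU _ _ v u) => //; [exact: conn1|rewrite inE].
Qed.

(** A derivation of C uses only seeds inside C; hence being generated is a local event. *)
Lemma gen_mono w w' C : (forall v, v \in C -> w v -> w' v) -> gen w C -> gen w' C.
Proof.
move=> sw gC; elim: gC sw => {C} [v wv|C C' u v _ IC _ IC' uC vC' uv|C C' u u' v _ IC _ IC' uC uC' uu' vu vu'] sw.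
- by apply: gen_seed; apply: sw; rewrite ?inE.
- by apply: gen_merge uC vC' uv; [apply: IC|apply: IC'] => x xC; apply: sw; rewrite inE xC ?orbT.
- by apply: gen_infect uC uC' uu' vu vu'; [apply: IC|apply: IC'] => x xC; apply: sw; rewrite !inE xC ?orbT.
Qed.

Lemma gen_occ w C : gen w C -> C \subset occ w.
Proof.
elim=> {C} [v wv|C C' u v _ sC _ sC' _ _ _|C C' u u' v _ sC _ sC' uC uC' uu' vu vu'].
- by rewrite sub1set occ_seed.
- by rewrite subUset sC.
- rewrite !subUset sC sC' sub1set !andbT.
  by apply: occ_infect uu' _ _ vu vu'; [apply: (subsetP sC)|apply: (subsetP sC')].
Qed.

Lemma occ_gen w v : v \in occ w -> exists2 C, gen w C & v \in C.
Proof.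
move: v; apply: occ_ind => [v wv|u u' v uu' [C gC uC] [C' gC' uC'] vu vu'].
  by exists [set v]; [exact: gen_seed|rewrite inE].
by exists (v |: (C :|: C')); [exact: gen_infect uu' vu vu'|rewrite !inE eqxx].
Qed.

Lemma occ_mono w w' : (forall v, w v -> w' v) -> occ w \subset occ w'.
Proof.
move=> ww'; apply/subsetP; apply: occ_ind => [v /ww'|u u' v uu' ou ou' vu vu'].
  exact: occ_seed.
exact: occ_infect uu' ou ou' vu vu'.
Qed.

(** An inclusion-maximal generated set containing C already contains every vertex it infects, and it
    absorbs any generated set through an adjacent vertex that becomes occupied. *)
Lemma gen_maximal w C : gen w C -> exists2 C' : {set V}, C \subset C' & [/\ gen w C',
  forall u u' v, u != u' -> u \in C' -> u' \in C' -> e v u -> e v u' -> v \in C' &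
  forall u v, u \in C' -> e u v -> v \in occ w -> v \in C'].
Proof.
move=> gC; have [C' /maxsetP[/asboolP gC' maxC'] sCC'] :=
  @maxset_exists _ (fun C => `[< gen w C >]) C (asboolT gC).
exists C' => //; split=> // [u u' v uu' uC uC' vu vu'|u v uC uv vo].
  rewrite -(maxC' (v |: (C' :|: C'))) ?inE ?eqxx //.
    by apply/asboolP; exact: gen_infect uC uC' uu' vu vu'.
  by rewrite finset.setUid subsetUr.
have [A gA vA] := occ_gen vo.
rewrite -(maxC' (C' :|: A)) ?inE ?vA ?orbT ?subsetUl //.
by apply/asboolP; exact: gen_merge uC vA uv.
Qed.

(** * Sizes of projections and the intermediate scale *)

Section Spread.
Variables (I : finType) (K : finType) (pr : V -> I -> K).

Definition spread C i := #|[set pr x i | x in C]|.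

Lemma spreadU C C' i : (spread (C :|: C') i <= spread C i + spread C' i)%N.
Proof. by rewrite /spread imsetU (leq_trans (leq_card_setU _ _)). Qed.

Lemma spread1 v i : spread [set v] i = 1%N.
Proof. by rewrite /spread imset_set1 cards1. Qed.

Lemma spreadS C C' i : C \subset C' -> (spread C i <= spread C' i)%N.
Proof. by move=> sCC'; rewrite subset_leq_card // imsetS. Qed.

(* Aizenman-Lebowitz: the spread of a generated set at most doubles in one step. *)
Lemma gen_intermediate w C (m : nat) : gen w C -> (0 < m)%N ->
  (exists i, m <= spread C i)%N ->
  exists2 C', gen w C' & (exists i, m <= spread C' i)%N /\ (forall i, spread C' i < 2 * m)%N.
Proof.
move=> gC m0.
have small A : ~ (exists i, m <= spread A i)%N -> forall i, (spread A i < m)%N.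
  by move=> nA i; rewrite ltnNge; apply/negP => ?; apply: nA; exists i.
elim: gC => {C} [v wv|C C' u v gC IC gC' IC' uC vC' uv|C C' u u' v gC IC gC' IC' uC uC' uu' vu vu'] exC.
- exists [set v]; first exact: gen_seed.
  by split=> // i; rewrite spread1; lia.
- have [/IC//|/small sC] := pselect (exists i, m <= spread C i)%N.
  have [/IC'//|/small sC'] := pselect (exists i, m <= spread C' i)%N.
  exists (C :|: C'); first exact: gen_merge uC vC' uv.
  split=> // i; apply: leq_ltn_trans (spreadU _ _ _) _.
  by have := sC i; have := sC' i; lia.
- have [/IC//|/small sC] := pselect (exists i, m <= spread C i)%N.
  have [/IC'//|/small sC'] := pselect (exists i, m <= spread C' i)%N.
  exists (v |: (C :|: C')); first exact: gen_infect uC uC' uu' vu vu'.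
  split=> // i; apply: leq_ltn_trans (spreadU _ _ _) _.
  (* The infected vertex adds one: (m - 1) + (m - 1) + 1 is still below 2 m. *)
  rewrite spread1; have := spreadU C C' i; have := sC i; have := sC' i.
  by lia.
Qed.

End Spread.

End Generation.

(** * Tori and boxes *)

Section Grid.
Variables (L : lattice) (d n0 : nat).
(** With side at least 2, ['I_n] is the ring of integers modulo n, so coordinates can be translated
    on the torus and on the box alike. *)
Local Notation n := n0.+2.
Local Notation V := (vertex d n).
Local Notation e := (adj L d n).
Local Notation A1 := (@Defs.adj1 L n).
Implicit Types (x y z : V) (i j : 'I_d) (a b c : 'I_n) (w : config V) (C : {set V}) (A : {set 'I_n}).

Lemma val_succ a : (a + 1 : 'I_n) = (a.+1 %% n)%N :> nat.
Proof. by rewrite /= modnDmr addn1. Qed.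

Lemma adj1_sym : symmetric A1.
Proof. by move=> a b; rewrite /Defs.adj1; case: L; rewrite orbC // eq_sym. Qed.

Lemma adj1_neq a b : A1 a b -> a != b.
Proof. by rewrite /Defs.adj1; case: L => [/andP[]//|]; apply: contraTneq => ->; rewrite orbb; lia. Qed.

Lemma ordSE a : ordS a = a + 1.
Proof. by apply: ord_inj; rewrite val_succ. Qed.

Lemma adj1_step a b : A1 a b -> b = a + 1 \/ a = b + 1.
Proof.
rewrite /Defs.adj1; case: L; first by rewrite !ordSE => /andP[_ /orP[]/eqP ->]; [left|right].
by case/orP => /eqP ab; [left|right]; apply: ord_inj; rewrite val_succ ab modn_small.
Qed.

Lemma adj1_succ a b : (a.+1 = b :> nat)%N -> A1 a b.
Proof.
move=> ab; rewrite /Defs.adj1; case: L; last by rewrite ab eqxx.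
apply/andP; split; first by apply/eqP => abE; move: ab; rewrite abE; lia.
by apply/orP; left; apply/eqP/ord_inj; rewrite ordSE val_succ ab modn_small.
Qed.

Lemma adj1_connT : conn A1 [set: 'I_n].
Proof.
move=> X a _ aX clX; apply/subsetP => b _.
have cl u v : u \in X -> A1 u v -> v \in X by move=> uX; apply: clX.
have [k] := ubnP (a - b + (b - a))%N; elim: k b => // k IHk b le_k.
have [ab|ba|/ord_inj <-//] := ltngtP (a : nat) b.
  have b1 : (b.-1 < n)%N by apply: leq_ltn_trans (leq_pred _) _.
  apply: (cl (Ordinal b1)); first by apply: IHk; rewrite /=; lia.
  by apply: adj1_succ; rewrite /=; lia.
have b1 : (b.+1 < n)%N by apply: leq_ltn_trans (ltn_ord a).
apply: (cl (Ordinal b1)); first by apply: IHk; rewrite /=; lia.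
by rewrite adj1_sym; apply: adj1_succ.
Qed.

(** On the box the danger is that a translated edge becomes the jump from n - 1 to 0. Both ends
    lying in the window would then force c = 0 and n - 1 < W. *)
Lemma adj1_shift a b (t : 'I_n) (c W : nat) : (W < n)%N ->
  (c <= (a + t)%R < c + W)%N -> (c <= (b + t)%R < c + W)%N ->
  A1 a b -> A1 (a + t) (b + t).
Proof.
move=> Wn at_ bt.
have key u v : (c <= (u + t)%R < c + W)%N -> (c <= (v + t)%R < c + W)%N ->
    u.+1 == v :> nat -> (u + t)%R.+1 == (v + t)%R :> nat.
  move=> ut vt /eqP uv; have vE : v = u + 1 by apply: ord_inj; rewrite val_succ uv modn_small.
  have vtE : v + t = (u + t) + 1 by rewrite vE addrAC.
  have := congr1 (@nat_of_ord n) vtE; rewrite val_succ => vtN.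
  have := ltn_ord (u + t); rewrite leq_eqVlt => /predU1P[ut1|ut1].
    by move: vtN vt ut; rewrite ut1 modnn /= => -> ; move: ut1 => [] ->; lia.
  by rewrite vtN modn_small.
rewrite /Defs.adj1; case: L => [|/orP[/(key _ _ at_ bt)->//|/(key _ _ bt at_)->]]; last by rewrite orbT.
rewrite !ordSE => /andP[ab /orP[]/eqP abE];
by rewrite (inj_eq (addIr t)) ab /= !(addrAC _ t 1) abE eqxx ?orbT.
Qed.

Definition upd x i c : V := [ffun j => if j == i then c else x j].

Lemma updE x i c : upd x i c i = c. Proof. by rewrite ffunE eqxx. Qed.

Lemma upd_id x i : upd x i (x i) = x.
Proof. by apply/ffunP => j; rewrite ffunE; case: eqP => // ->. Qed.

Lemma updD x i j c : j != i -> upd x i c j = x j.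
Proof. by move=> ji; rewrite ffunE (negbTE ji). Qed.

Lemma upd_upd x i b c : upd (upd x i b) i c = upd x i c.
Proof. by apply/ffunP => j; rewrite !ffunE; case: eqP. Qed.

Lemma updC x i j b c : i != j -> upd (upd x i b) j c = upd (upd x j c) i b.
Proof.
move=> ij; apply/ffunP => k; rewrite !ffunE; case: eqVneq => // ->.
by rewrite eq_sym (negbTE ij).
Qed.

Lemma adjP x y : e x y -> exists2 i, A1 (x i) (y i) & y = upd x i (y i).
Proof.
case/existsP => i /andP[xy /forallP xyj]; exists i => //; apply/ffunP => j.
by rewrite ffunE; case: eqP => [->//|/eqP ji]; have /implyP/(_ ji)/eqP := xyj j.
Qed.

Lemma adj_upd x i b c : A1 b c -> e (upd x i b) (upd x i c).
Proof.
move=> bc; apply/existsP; exists i; rewrite !updE bc /=.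
by apply/forallP => j; apply/implyP => ji; rewrite !updD.
Qed.

Lemma adj_updE x i c : A1 (x i) c -> e x (upd x i c).
Proof. by move=> xc; rewrite -{1}(upd_id x i); apply: adj_upd. Qed.

Lemma adj_sym : symmetric e.
Proof.
move=> x y; apply: eq_existsb => i; rewrite adj1_sym; congr andb.
by apply: eq_forallb => j; rewrite [x j == _]eq_sym.
Qed.

Definition proj i C : {set 'I_n} := [set x i | x : V in C].
Definition vcoord x i := x i.
Local Notation spread := (spread vcoord).

Lemma proj_in x C i : x \in C -> x i \in proj i C.
Proof. by move=> xC; apply/imsetP; exists x. Qed.

Lemma conn_proj C i : conn e C -> conn A1 (proj i C).
Proof.
move=> cC X a /imsetP[x xC ->] xX clX; apply/subsetP => b /imsetP[y yC ->].
suff CX : C \subset [set z : V | z i \in X] by have := subsetP CX _ yC; rewrite inE.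
apply: (cC _ x) => //; first by rewrite inE.
move=> u v; rewrite !inE => uX uC vC /adjP[j uv vE].
have [ij|ij] := eqVneq i j; last by rewrite vE updD.
by apply: (clX (u i)) => //; rewrite ?proj_in // ij.
Qed.

(* A connected set stable under infection is a product; the union over its
   points of the [i]-fibres is found as a largest connected fibre. *)
Lemma conn_fibre C i : conn e C ->
  (forall u u' v, u != u' -> u \in C -> u' \in C -> e v u -> e v u' -> v \in C) ->
  forall x c, x \in C -> c \in proj i C -> upd x i c \in C.
Proof.
move=> cC clC x0 c0 x0C c0C.
pose P A := `[< conn A1 A /\ exists2 x, x \in C & x i \in A /\ (forall c, c \in A -> upd x i c \in C) >].
have P0 : P [set x0 i].
  apply/asboolP; split; first exact: conn1.
  by exists x0 => //; split=> [|c /set1P ->]; rewrite ?inE // upd_id.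
have [A /maxsetP[/asboolP[cA [x xC [xA fA]]] maxA] _] := @maxset_exists _ P _ P0.
(* The points of C that carry a whole fibre over the maximal A. It remains to see that this set is
   closed under the edges of C. *)
pose Y := [set z in C | (z i \in A) && [forall (c | c \in A), upd z i c \in C]].
have YP z : reflect [/\ z \in C, z i \in A & forall c, c \in A -> upd z i c \in C] (z \in Y).
  rewrite !inE; apply: (iffP and3P) => -[zC zA fz]; split=> //.
    by move=> c cA'; move/forallP: fz => /(_ c)/implyP; apply.
  by apply/forallP => c; apply/implyP; exact: fz.
have CY : C \subset Y.
  apply: (cC Y x) => //; first exact/YP.
  move=> u v /YP[_ uA fu] uC vC /adjP[j uv vE]; apply/YP.
  have [ji|ij] := eqVneq i j; last first.
    have vi : v i = u i by rewrite vE updD.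
    split=> //; first by rewrite vi.
    (* Across an edge in another direction the fibre is copied point by point: the new vertex has
       one neighbour already reached in the fibre of v and one in the fibre of u. *)
    have sub : A \subset [set c | upd v i c \in C].
      apply: (cA _ (u i)) => //; first by rewrite inE -vi upd_id.
      move=> b c; rewrite !inE => vb bA cA' bc.
      apply: (clC (upd v i b) (upd u i c)) => //; first 1 last.
      - exact: fu.
      - by apply: adj_upd; rewrite adj1_sym.
      - rewrite vE -updC // adj_sym; apply: adj_updE; rewrite updD // eq_sym.
        by [].
      - apply/eqP => /(congr1 (fun z : V => z i)); rewrite !updE => bcE.
        by have := adj1_neq bc; rewrite bcE eqxx.
    by move=> c /(subsetP sub); rewrite inE.
  have vuE c : upd v i c = upd u i c by rewrite vE ji upd_upd.
  (* Along an edge in direction i the two fibres coincide, and A together with [v i] is again an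
     admissible fibre; maximality gives the membership. *)
  suff vA : v i \in A by split=> // c cA'; rewrite vuE; exact: fu.
  rewrite -(maxA (v i |: A)) ?setU11 ?subsetUr //; apply/asboolP; split.
    rewrite setUC; apply: (connU adj1_sym cA (@conn1 _ A1 (v i)) uA) => //; first by rewrite inE.
    by rewrite ji.
  exists u => //; split; first by rewrite inE uA orbT.
  by move=> c /setU1P[->|]; [rewrite -vuE upd_id|exact: fu].
have /YP[_ _ fx0] := subsetP CY _ x0C.
by apply: fx0; case/imsetP: c0C => y /(subsetP CY)/YP[_ yA _] ->.
Qed.

Lemma upd_closedT C x : x \in C -> (forall z i c, z \in C -> upd z i c \in C) -> C = [set: V].
Proof.
move=> xC clC; apply/setP => y; rewrite [RHS]inE.
pose mix (s : seq 'I_d) : V := [ffun j => if j \in s then y j else x j].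
have mC s : mix s \in C.
  elim: s => [|i s IHs]; first by rewrite (_ : mix [::] = x) //; apply/ffunP => j; rewrite ffunE.
  rewrite (_ : mix (i :: s) = upd (mix s) i (y i)) ?clC //.
  by apply/ffunP => j; rewrite !ffunE inE; case: eqP => // ->.
rewrite (_ : y = mix (enum 'I_d)) ?mC //; apply/ffunP => j.
by rewrite ffunE mem_enum.
Qed.

(** The runs of A going up and down from c together form a set closed under adjacency inside A,
    hence all of A. Neither run reaches length m, because every arc of m points leaves A. *)
Lemma conn_arc A c (m : nat) : conn A1 A -> c \in A ->
  (forall a, exists2 s, (s < m)%N & a + s%:R \notin A) ->
  forall b, b \in A -> exists2 s, (s < m)%N & b = c + s%:R \/ b = c - s%:R.
Proof.
move=> cA cA' noarc.
pose runr s := [forall t : 'I_s.+1, c + (t : nat)%:R \in A].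
pose runl s := [forall t : 'I_s.+1, c - (t : nat)%:R \in A].
have runrP s : reflect (forall t, (t <= s)%N -> c + t%:R \in A) (runr s).
  apply: (iffP forallP) => [h t ts|h t]; last by apply: h; rewrite -ltnS.
  exact: (h (Ordinal (ts : (t < s.+1)%N))).
have runlP s : reflect (forall t, (t <= s)%N -> c - t%:R \in A) (runl s).
  apply: (iffP forallP) => [h t ts|h t]; last by apply: h; rewrite -ltnS.
  exact: (h (Ordinal (ts : (t < s.+1)%N))).
have lr s : runr s -> (s < m)%N.
  move=> /runrP rs; have [s' s'm] := noarc c; rewrite ltnNge.
  by move=> /negP nA; apply/negP => ms; apply: nA; apply: rs; apply: leq_trans (ltnW s'm) _.
have ll s : runl s -> (s < m)%N.
  move=> /runlP rs; have [s' s'm] := noarc (c - s%:R); rewrite ltnNge.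
  move=> /negP nA; apply/negP => ms; apply: nA.
  have s's : (s' <= s)%N by apply: leq_trans (ltnW s'm) _.
  rewrite (_ : c - s%:R + s'%:R = c - (s - s')%:R); first by apply: rs; rewrite leq_subr.
  by rewrite natrB //; ring.
pose X : {set 'I_n} := [set b | `[< exists s, (runr s /\ b = c + s%:R) \/ (runl s /\ b = c - s%:R) >]].
have XP b : reflect (exists s, (runr s /\ b = c + s%:R) \/ (runl s /\ b = c - s%:R)) (b \in X).
  by rewrite inE; apply: asboolP.
have r0 : runr 0 by apply/runrP => t; rewrite leqn0 => /eqP ->; rewrite addr0.
have l0 : runl 0 by apply/runlP => t; rewrite leqn0 => /eqP ->; rewrite subr0.
have extr s : runr s -> c + s.+1%:R \in A -> runr s.+1.
  move=> /runrP rs sA; apply/runrP => t; rewrite leq_eqVlt => /predU1P[->//|]; exact: rs.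
have extl s : runl s -> c - s.+1%:R \in A -> runl s.+1.
  move=> /runlP rs sA; apply/runlP => t; rewrite leq_eqVlt => /predU1P[->//|]; exact: rs.
have AX : A \subset X.
  apply: (cA X c) => //; first by apply/XP; exists 0%N; left; rewrite addr0.
  move=> u v /XP[s [[rs uE]|[ls uE]]] uA vA /adj1_step[vE|vE]; apply/XP.
  - have vE' : v = c + s.+1%:R by rewrite vE uE -natr1 addrA.
    by exists s.+1; left; split=> //; apply: extr; rewrite -?vE'.
  - case: s rs uE => [|s] rs uE; last first.
      exists s; left; split.
        by apply/runrP => t ts; apply: (runrP _ rs); apply: leq_trans ts _.
      by apply: (addIr 1); rewrite -vE uE -natr1 addrA.
    have vE' : v = c - 1%:R by apply: (addIr 1); rewrite -vE uE addr0 subrK.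
    by exists 1%N; right; split=> //; apply: extl; rewrite -?vE'.
  - case: s ls uE => [|s] ls uE; last first.
      exists s; right; split.
        by apply/runlP => t ts; apply: (runlP _ ls); apply: leq_trans ts _.
      by rewrite vE uE -natr1; ring.
    have vE' : v = c + 1%:R by rewrite vE uE subr0.
    by exists 1%N; left; split=> //; apply: extr; rewrite -?vE'.
  - have vE' : v = c - s.+1%:R by apply: (addIr 1); rewrite -vE uE -natr1; ring.
    by exists s.+1; right; split=> //; apply: extl; rewrite -?vE'.
move=> b /(subsetP AX)/XP[s [[rs bE]|[ls bE]]].
  by exists s; [exact: lr|left].
by exists s; [exact: ll|right].
Qed.

(** Otherwise [conn_arc] confines A to fewer than m steps on either side of one point, which leaves
    at most 2 m points. *)
Lemma arc_in A (m : nat) : conn A1 A -> (2 * m < #|A|)%N ->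
  exists a, forall s, (s < m)%N -> a + s%:R \in A.
Proof.
move=> cA mA; apply: contrapT => noarc.
have [c cA'] : exists c, c \in A by apply/set0Pn; rewrite -card_gt0; apply: leq_ltn_trans mA.
have noarc' a : exists2 s, (s < m)%N & a + s%:R \notin A.
  apply: contrapT => na; apply: noarc; exists a => s sm.
  by apply/negPn/negP => sA; apply: na; exists s.
have inA := conn_arc cA cA' noarc'.
have : A \subset [set c + (s : nat)%:R | s : 'I_m] :|: [set c - (s : nat)%:R | s : 'I_m].
  apply/subsetP => b /inA[s sm [->|->]]; rewrite inE; apply/orP; [left|right];
  by apply/imsetP; exists (Ordinal sm).
move=> /subset_leq_card; rewrite leqNgt => /negP; apply.
apply: leq_ltn_trans (leq_card_setU _ _) _.
apply: leq_ltn_trans mA; rewrite mul2n -addnn.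
by apply: leq_add; apply: leq_trans (leq_imset_card _ _) _; rewrite card_ord.
Qed.

Lemma arc_card A a (m : nat) : (m <= n)%N -> (forall s, (s < m)%N -> a + s%:R \in A) -> (m <= #|A|)%N.
Proof.
move=> mn aA; have inj : injective (fun s : 'I_m => a + (s : nat)%:R).
  move=> s t /addrI/(congr1 (@nat_of_ord n)); rewrite !Zp_nat /= !modn_small ?(leq_trans (ltn_ord _)) //.
  exact: ord_inj.
rewrite -[m in leqLHS]card_ord -(card_imset _ inj); apply: subset_leq_card.
by apply/subsetP => b /imsetP[s _ ->]; exact: aA.
Qed.

(* Here and in [cube], coordinates are taken modulo [n], also in the box. *)
Definition arc_hit w (m : nat) := forall x i, exists2 s, (s < m)%N & w (upd x i (x i + s%:R)).

(** Enlarge C to a maximal generated set, which is a product by [conn_fibre]. A projection with more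
    than 2 m points contains an arc of length m. A segment over that arc next to the set contains an
    occupied vertex, so every other projection grows to everything. As d >= 2 there is another
    direction, and it in turn makes the original one full. *)
Lemma growth w C (m : nat) : (1 < d)%N -> gen e w C -> (2 * m < n)%N ->
  (exists i, 2 * m < spread C i)%N -> arc_hit w m -> occ e w = [set: V].
Proof.
move=> d1 gC mn [i iC] hit.
have [C' sCC' [gC' clC' oC']] := gen_maximal gC.
have cC' := gen_conn adj_sym gC'.
have fib k := @conn_fibre C' k cC' clC'.
have [x0 x0C] : exists x, x \in C' by have [x xC] := gen_nonempty gC'; exists x.
have full k j : (2 * m < #|proj k C'|)%N -> j != k -> proj j C' = [set: 'I_n].
  move=> kC jk; have [a aP] := arc_in (conn_proj cC') kC.
  apply/eqP; rewrite -finset.subTset; apply: (adj1_connT (in_setT (x0 j))); first exact: proj_in.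
  move=> b b' /imsetP[x xC ->] _ _ xb'.
  (* The segment runs over the arc in direction k, with coordinate j moved to the neighbouring value
     [b']. Its occupied vertex is adjacent to the point of the set with the old value of coordinate
     j. *)
  have [s sm] := hit (upd (upd x j b') k a) k; rewrite upd_upd updE => ws.
  have kj : k != j by rewrite eq_sym.
  rewrite -updC // in ws; have zC := fib k x _ xC (aP s sm).
  have : upd (upd x k (a + s%:R)) j b' \in C'.
    apply: (oC' _ _ zC); last exact: occ_seed.
    by apply: adj_updE; rewrite updD.
  by move=> /(proj_in j); rewrite updE.
have iC' : (2 * m < #|proj i C'|)%N.
  by apply: leq_trans iC _; apply: spreadS.
have [j ji] : exists j, j != i.
  have [i0|i0] := eqVneq (i : nat) 0%N.
    by exists (Ordinal d1); rewrite -val_eqE /= i0.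
  by exists (Ordinal (ltnW d1)); rewrite -val_eqE /= eq_sym.
have jT := full _ _ iC' ji.
have iT : proj i C' = [set: 'I_n].
  by apply: (full j); rewrite ?jT ?cardsT ?card_ord // eq_sym.
have allT k : proj k C' = [set: 'I_n] by have [->//|] := eqVneq k i; apply: full.
apply/eqP; rewrite -finset.subTset -(@upd_closedT C' x0) //; first exact: gen_occ.
by move=> z k c zC; apply: fib => //; rewrite allT inE.
Qed.

(** A maximal generated set absorbs its occupied neighbours; when every vertex becomes occupied, it
    therefore spreads along all lines. *)
Lemma occ_gen_setT w : occ e w = [set: V] -> gen e w [set: V].
Proof.
move=> oT; pose v0 : V := [ffun=> 0].
have [C gC _] : exists2 C, gen e w C & v0 \in C by apply: occ_gen; rewrite oT inE.
have [C' _ [gC' _ oC']] := gen_maximal gC.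
have [x xC] := gen_nonempty gC'.
rewrite -(@upd_closedT C' x) // => z i c zC.
have : [set: 'I_n] \subset [set c | upd z i c \in C'].
  apply: (adj1_connT (in_setT (z i))); first by rewrite inE upd_id.
  move=> b b'; rewrite !inE => bC _ _ bb'.
  by apply: (oC' _ _ bC); [exact: adj_upd|rewrite oT inE].
by move=> /subsetP/(_ c (in_setT _)); rewrite inE.
Qed.

Lemma complete_gen w (m : nat) : (0 < d)%N -> complete_occupation e 2 w -> (0 < m <= n)%N ->
  exists2 C, gen e w C & (exists i, m <= spread C i)%N /\ (forall i, spread C i < 2 * m)%N.
Proof.
move=> d0 /complete_occ/occ_gen_setT gT /andP[m0 mn].
apply: gen_intermediate gT m0 _; exists (Ordinal d0).
apply: leq_trans mn _; rewrite /spread (_ : imset _ _ = [set: 'I_n]) ?cardsT ?card_ord //.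
apply/setP => c; rewrite inE; apply/imsetP; exists [ffun=> c] => //.
by rewrite /vcoord ffunE.
Qed.

(** * Cubes, local events and their translation *)

Definition cube x (W : nat) : {set V} := [set y : V | [forall i, ((y i - x i)%R < W)%N]].

Lemma cubeP x W y : reflect (forall i, ((y i - x i)%R < W)%N) (y \in cube x W).
Proof. by rewrite inE; apply: forallP. Qed.

Definition corner x (r : nat) : V := [ffun i => x i - r%:R].

Lemma val_natr_le (k : nat) : ((k%:R : 'I_n) <= k)%N.
Proof. by rewrite Zp_nat /=; apply: leq_mod. Qed.

(** A projection with fewer than r points cannot contain an arc of r points, so [conn_arc] keeps
    each coordinate less than r steps away from that of v. *)
Lemma conn_in_cube C v (r : nat) : conn e C -> v \in C -> (r <= n)%N ->
  (forall i, spread C i < r)%N -> C \subset cube (corner v r) (2 * r).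
Proof.
move=> cC vC rn Cr; apply/subsetP => y yC; apply/cubeP => i.
have r0 : (0 < r)%N by apply: leq_ltn_trans (Cr i).
have noarc a : exists2 s, (s < r)%N & a + s%:R \notin proj i C.
  apply: contrapT => na; have := Cr i; rewrite ltnNge => /negP; apply.
  apply: (@arc_card _ a) => // s sr; apply/negPn/negP => sC.
  by apply: na; exists s.
have [s sr yE] := conn_arc (conn_proj cC) (proj_in i vC) noarc (proj_in i yC).
rewrite ffunE; case: yE => ->.
  rewrite (_ : _ - _ = (r + s)%:R); last by rewrite natrD; ring.
  by apply: leq_ltn_trans (val_natr_le _) _; lia.
rewrite (_ : _ - _ = (r - s)%:R); last by rewrite natrB ?(ltnW sr) //; ring.
by apply: leq_ltn_trans (val_natr_le _) _; lia.
Qed.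

Lemma card_cube x (W : nat) : (#|cube x W| <= W ^ d)%N.
Proof.
pose sh y : V := [ffun i => y i - x i].
have sh_inj : injective sh.
  move=> y z /ffunP yz; apply/ffunP => i.
  by have := yz i; rewrite !ffunE => /addIr.
pose F : {set 'I_n} := [set c : 'I_n | (c < W)%N].
have FW : (#|F| <= W)%N.
  have -> : W = #|'I_W| by rewrite card_ord.
  apply: (@leq_trans #|[set (s : nat)%:R | s : 'I_W] : {set 'I_n}|); last exact: leq_imset_card.
  apply: subset_leq_card; apply/subsetP => c; rewrite inE => cW.
  by apply/imsetP; exists (Ordinal cW); rewrite //= natr_Zp.
rewrite -(card_imset _ sh_inj).
apply: (@leq_trans #|[set f : {ffun 'I_d -> 'I_n} | f \in ffun_on (mem F)]|).
  apply: subset_leq_card; apply/subsetP => _ /imsetP[y /cubeP yW ->]; rewrite inE.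
  by apply/ffun_onP => i; rewrite ffunE inE.
by rewrite cardsE card_ffun_on card_ord; case: (posnP d) => [->//|d0]; rewrite leq_exp2r.
Qed.

Definition seeded w x (W M : nat) :=
  exists2 C, gen e w C & C \subset cube x W /\ exists i, (M <= spread C i)%N.

Lemma seeded_depends w w' x (W M : nat) : {in cube x W, w =1 w'} ->
  seeded w x W M -> seeded w' x W M.
Proof.
move=> ww' [C gC [sC MC]]; exists C => //; apply: gen_mono gC => v /(subsetP sC) vW.
by rewrite ww'.
Qed.

Lemma sub_val (a b : 'I_n) (W : nat) : ((b - a)%R < W)%N -> (a + W <= n)%N -> (a <= b < a + W)%N.
Proof.
move=> bW aW; have -> : (b : nat) = (a + (b - a)%R)%N.
  rewrite -{1}(subrK a b) addrC /= modn_small //.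
  by apply: leq_trans aW; rewrite ltn_add2l.
by rewrite leq_addr ltn_add2l.
Qed.

Definition shift (t : V) y : V := [ffun i => y i + t i].

Lemma shift_inj t : injective (shift t).
Proof.
by move=> y z /ffunP yz; apply/ffunP => i; have := yz i; rewrite !ffunE => /addIr.
Qed.

(* The target cube does not wrap around, so the translation is compatible with
   adjacency on the box as well as on the torus. *)
Lemma seeded_shift w x x' (W M : nat) : (W < n)%N -> (forall i, x' i + W <= n)%N ->
  seeded [ffun y => w (shift [ffun i => x' i - x i] y)] x W M -> seeded w x' W M.
Proof.
move=> Wn x'W; set t : V := [ffun i => _].
have in_x' y i : y \in cube x W -> ((shift t y i - x' i)%R < W)%N.
  by move=> /cubeP/(_ i); rewrite !ffunE (_ : _ + _ - _ = y i - x i) //; ring.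
have adj_shift u v : u \in cube x W -> v \in cube x W -> e u v -> e (shift t u) (shift t v).
  move=> uW vW /existsP[i /andP[uv /forallP uvj]]; apply/existsP; exists i; apply/andP; split.
    have := sub_val (in_x' u i uW) (x'W i); have := sub_val (in_x' v i vW) (x'W i).
    by rewrite !ffunE => vi ui; apply: (@adj1_shift _ _ _ (x' i) W).
  apply/forallP => j; apply/implyP => ji; rewrite !ffunE.
  by have /implyP/(_ ji)/eqP -> := uvj j.
case=> C gC [sC [i MC]]; exists (shift t @: C).
  elim: gC sC {MC} => {C} [v|C C' u v _ IC _ IC' uC vC' uv|C C' u u' v _ IC _ IC' uC uC' uu' vu vu'].
  - by rewrite ffunE imset_set1 => wv _; exact: gen_seed.
  - rewrite subUset imsetU => /andP[sC sC'].
    apply: (@gen_merge _ _ _ _ _ (shift t u) (shift t v)); [exact: IC|exact: IC'|..].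
    + exact: imset_f.
    + exact: imset_f.
    + by apply: adj_shift => //; [exact: (subsetP sC)|exact: (subsetP sC')].
  - rewrite !subUset !imsetU imset_set1 sub1set => /and3P[vW sC sC'].
    apply: (@gen_infect _ _ _ _ _ (shift t u) (shift t u')); [exact: IC|exact: IC'|..].
    + exact: imset_f.
    + exact: imset_f.
    + by rewrite (inj_eq (@shift_inj t)).
    + by apply: adj_shift => //; exact: (subsetP sC).
    + by apply: adj_shift => //; exact: (subsetP sC').
split.
  apply/subsetP => _ /imsetP[y yC ->]; apply/cubeP => j.
  by apply: in_x'; exact: (subsetP sC).
exists i; apply: leq_trans MC _; rewrite /spread.
rewrite -[X in (X <= _)%N](card_imset _ (@addIr _ (t i))); apply: subset_leq_card.
apply/subsetP => _ /imsetP[_ /imsetP[y yC ->] ->]; apply/imsetP; exists (shift t y).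
  exact: imset_f.
by rewrite /vcoord [RHS]ffunE.
Qed.

(** The hyperplane at a, or else both its neighbours, must contain a seed. For a newly infected
    vertex, if one of its two infecting neighbours lies in its hyperplane, induction applies there;
    otherwise they are the two opposite neighbours in direction i, and the alternatives for their
    hyperplanes combine. *)
Lemma gen_slab w C i a : gen e w C -> a \in proj i C ->
  (exists2 x, x \in C & w x /\ x i = a) \/
  ((exists2 x, x \in C & w x /\ x i = a + 1) /\ (exists2 x, x \in C & w x /\ x i = a - 1)).
Proof.
have mono (C1 C2 : {set V}) c : C1 \subset C2 -> (exists2 x, x \in C1 & w x /\ x i = c) ->
    exists2 x, x \in C2 & w x /\ x i = c.
  by move=> /subsetP s [x /s xC wx]; exists x.
have mono2 (C1 C2 : {set V}) c : C1 \subset C2 ->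
  (exists2 x, x \in C1 & w x /\ x i = c) \/
  ((exists2 x, x \in C1 & w x /\ x i = c + 1) /\ (exists2 x, x \in C1 & w x /\ x i = c - 1)) ->
  (exists2 x, x \in C2 & w x /\ x i = c) \/
  ((exists2 x, x \in C2 & w x /\ x i = c + 1) /\ (exists2 x, x \in C2 & w x /\ x i = c - 1)).
  by move=> s [h|[h h']]; [left|right; split]; apply: mono s _.
move=> gC; elim: gC a => {C} [v wv|C C' u v _ IC _ IC' _ _ _|C C' u u' v _ IC _ IC' uC uC' uu' vu vu'] a.
- rewrite /proj imset_set1 inE => /eqP ->; left; exists v; rewrite ?inE //.
- rewrite /proj imsetU => /setUP[/IC|/IC']; apply: mono2; [exact: subsetUl|exact: subsetUr].
have sC : C \subset v |: (C :|: C') by rewrite setUCA subsetUl.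
have sC' : C' \subset v |: (C :|: C') by rewrite setUA subsetUr.
rewrite /proj imsetU1 imsetU => /setU1P[->|/setUP[/IC|/IC']]; last 2 first.
- exact: mono2.
- exact: mono2.
have Iu := mono2 _ _ (u i) sC (IC _ (proj_in i uC)).
have Iu' := mono2 _ _ (u' i) sC' (IC' _ (proj_in i uC')).
have [ui|ui] := eqVneq (u i) (v i); first by rewrite -ui.
have [ui'|ui'] := eqVneq (u' i) (v i); first by rewrite -ui'.
have [j vuj uE] := adjP vu; have [j' vuj' uE'] := adjP vu'.
have ji : i = j by apply/eqP/negPn/negP => ij; rewrite uE updD ?eqxx in ui.
have ji' : i = j' by apply/eqP/negPn/negP => ij; rewrite uE' updD ?eqxx in ui'.
subst j j'.
have [uN|uN] := adj1_step vuj; have [uN'|uN'] := adj1_step vuj'.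
- by case/eqP: uu'; rewrite uE uE' uN uN'.
- have uN1 : u' i = v i - 1 by rewrite uN' addrK.
  rewrite uN uN1 in Iu Iu'; rewrite addrK in Iu; rewrite subrK in Iu'.
  by tauto.
- have uN1 : u i = v i - 1 by rewrite uN addrK.
  rewrite uN' uN1 in Iu Iu'; rewrite subrK in Iu; rewrite addrK in Iu'.
  by tauto.
- by case/eqP: uu'; rewrite uE uE' (_ : u i = u' i) //; apply: (addIr 1); rewrite -uN.
Qed.

(** By [gen_slab] every value of the projection is within one step of the coordinate of a seed, so a
    seed accounts for at most three values. *)
Lemma gen_occupied w C i : gen e w C -> (spread C i <= 3 * #|[set x in C | w x]|)%N.
Proof.
move=> gC; set O := [set x in C | w x].
have OP x : x \in C -> w x -> x \in O by rewrite inE => -> ->.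
have : [set vcoord x i | x in C] \subset
    [set x i | x : V in O] :|: ([set x i + 1 | x : V in O] :|: [set x i - 1 | x : V in O]).
  apply/subsetP => a /(gen_slab gC)[[x xC [wx <-]]|[[x xC [wx xa]] _]]; rewrite !inE.
    by rewrite (imset_f (fun x : V => x i)) ?OP.
  have -> : a = x i - 1 by rewrite xa addrK.
  by rewrite (imset_f (fun x : V => x i - 1)) ?OP // !orbT.
move=> /subset_leq_card/leq_trans; apply.
apply: leq_trans (leq_card_setU _ _) _; rewrite mulSn leq_add ?leq_imset_card //.
apply: leq_trans (leq_card_setU _ _) _; rewrite mul2n -addnn.
by apply: leq_add; exact: leq_imset_card.
Qed.

Definition segment x i (k : nat) : {set V} := [set upd x i (s : nat)%:R | s : 'I_k].

Lemma gen_segment w x i (k : nat) : (k < n)%N ->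
  (forall y, y \in segment x i k.+1 -> w y) -> gen e w (segment x i k.+1).
Proof.
have inS s k' : (s < k')%N -> upd x i s%:R \in segment x i k'.
  by move=> sk; apply/imsetP; exists (Ordinal sk).
elim: k => [_|k IHk k1n] wS.
  rewrite (_ : segment x i 1 = [set upd x i 0]); first by apply: gen_seed; apply: wS; exact: (inS 0%N).
  apply/setP => y; rewrite inE; apply/imsetP/eqP => [[s _ ->]|->]; first by rewrite ord1.
  by exists ord0.
have -> : segment x i k.+2 = segment x i k.+1 :|: [set upd x i k.+1%:R].
  apply/setP => y; rewrite !inE; apply/imsetP/orP => [[s _ ->]|[/imsetP[s _ ->]|/eqP ->]].
  - have := ltn_ord s; rewrite ltnS leq_eqVlt => /predU1P[->|sk]; first by right.
    by left; exact: inS.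
  - by exists (widen_ord (leqnSn _) s).
  - by exists ord_max.
apply: (@gen_merge _ _ _ _ _ (upd x i k%:R) (upd x i k.+1%:R)).
- apply: IHk; first exact: ltnW.
  by move=> y /imsetP[s _ ->]; apply: wS; apply: inS; apply: ltnW; rewrite ltnS.
- by apply: gen_seed; apply: wS; exact: inS.
- exact: inS.
- by rewrite inE.
- by apply: adj_upd; apply: adj1_succ; rewrite !Zp_nat /= !modn_small // ltnW.
Qed.

Lemma spread_segment x i (k : nat) : (k <= n)%N -> (k <= spread (segment x i k) i)%N.
Proof.
move=> kn; apply: (@arc_card _ 0) => // s sk.
apply/imsetP; exists (upd x i s%:R); last by rewrite /vcoord updE add0r.
by apply/imsetP; exists (Ordinal sk).
Qed.

End Grid.

(** * Probability of local and pivotal events *)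

Section Percolation.
Variables (R : realType) (L : lattice) (d n0 : nat) (p : R).
Hypothesis d_gt1 : (1 < d)%N.
Hypothesis p_gt0 : 0 < p.
Hypothesis p_lt1 : p < 1.
Local Notation n := n0.+2.
Local Notation V := (vertex d n).
Local Notation e := (adj L d n).
Local Notation mu := (@product_law R V p).
Local Notation complete := (complete_occupation e 2).
Local Notation f := (fC e 2 R).

Let p01 : 0 <= p <= 1. Proof. by rewrite !ltW. Qed.
Let mu_ge0 w : 0 <= mu w. Proof. exact: product_law_ge0. Qed.
Let q_ge0 : 0 <= 1 - p. Proof. by rewrite subr_ge0 ltW. Qed.
Let q_le1 : 1 - p <= 1. Proof. by rewrite lerBlDr lerDl ltW. Qed.
Hint Resolve mu_ge0 q_ge0 q_le1 : core.

Lemma card_vertex : #|{: V}| = (n ^ d)%N.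
Proof. by rewrite card_ffun !card_ord. Qed.

Lemma vacate_sub (v u : V) (w : config V) : vacate v w u -> w u.
Proof. by rewrite ffunE => /andP[]. Qed.

Lemma arc_hit_vacate (v : V) w m : arc_hit (vacate v w) m -> arc_hit w m.
Proof. by move=> h x i; have [s sm /vacate_sub ws] := h x i; exists s. Qed.

Lemma complete_mono (w w' : config V) : (forall v, w v -> w' v) -> complete w -> complete w'.
Proof.
move=> ww' /complete_occ oT; apply/complete_occ/eqP.
by rewrite -finset.subTset -oT occ_mono.
Qed.

(** A union bound over base points and directions. The exponent is m - 1 because the vacated vertex
    may lie on the segment. *)
Definition miss (m : nat) : R := (d * n ^ d)%N%:R * (1 - p) ^+ m.-1.

Lemma Prob_miss (v : V) (m : nat) : (m <= n)%N ->
  Prob mu (fun w => ~ arc_hit (vacate v w) m) <= miss m.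
Proof.
move=> mn; pose U (x : V * 'I_d) := [set upd x.1 x.2 (x.1 x.2 + (s : nat)%:R) | s : 'I_m] :\ v.
apply: (@le_trans _ _ (Prob mu (fun w => exists x, forall u, u \in U x -> ~~ w u))).
  apply: ler_Prob => // w; apply: contra_notP => nex x i.
  apply: contrapT => nhit; apply: nex; exists (x, i) => u.
  rewrite in_setD1 => /andP[uv /imsetP[s _ uE]]; apply/negP => wu; apply: nhit.
  by exists s => //; rewrite -uE ffunE uv.
apply: le_trans (Prob_exists _ _) _ => //.
rewrite /miss (_ : (d * n ^ d)%N = #|{: V * 'I_d}|); last first.
  by rewrite card_prod card_vertex card_ord mulnC.
rewrite mulr_natl -sumr_const; apply: ler_sum => -[x i] _.
rewrite Prob_vacant // ler_wiXn2l //.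
rewrite /U /=; set S := [set _ | _ in _]; have mS : m = #|S|.
  rewrite card_imset ?card_ord // => s t /ffunP/(_ i); rewrite !updE => /addrI.
  move/(congr1 (@nat_of_ord n)); rewrite !Zp_nat /= !modn_small ?(leq_trans (ltn_ord _)) //.
  exact: ord_inj.
by rewrite mS (cardsD1 v S); case: (v \in S) => //=; rewrite leq_pred.
Qed.

Lemma fC_val w : f w = 1 \/ f w = -1.
Proof. by rewrite /fC; case: ifP => _; [left|right]. Qed.

(** Complete occupation yields a generated set at the scale 2 m + 1 required by [growth], with
    projections below r. If it avoided v, it would be generated without v as well and would fill
    everything. So it contains v and lies in the cube around v. *)
Lemma pivotal_seeded (v : V) w (m : nat) : let r := (2 * (2 * m).+1)%N in (r <= n)%N ->
  f w <> f (vacate v w) ->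
  ~ arc_hit (vacate v w) m \/ seeded L w (corner v r) (2 * r) (2 * m).+1.
Proof.
move=> r rn piv; have [hit|] := pselect (arc_hit (vacate v w) m); last by left.
right; have [cw nc] : complete w /\ ~ complete (vacate v w).
  move: piv; rewrite /fC; case: asboolP => [cw|ncw]; case: asboolP => // cv.
  by case: ncw; apply: complete_mono cv => u; exact: vacate_sub.
have Mn : (0 < (2 * m).+1 <= n)%N by apply: leq_trans rn; rewrite /r; lia.
have [C gC [iC iC']] := complete_gen (ltnW d_gt1) cw Mn.
have vC : v \in C.
  apply/negPn/negP => vC; apply/nc/complete_occ; apply: growth d_gt1 _ _ iC hit.
    apply: gen_mono gC => u uC wu; rewrite ffunE wu andbT.
    by apply: contraNneq vC => <-.
  by have /andP[] := Mn.
exists C => //; split=> //; apply: conn_in_cube => //; exact: (gen_conn (@adj_sym _ _ _) gC).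
Qed.

(** This turns (1 - h)^N >= 1/4 into N h <= 3. *)
Lemma bernoulli (h : R) (N : nat) : 0 <= h <= 1 -> (1 - h) ^+ N * (1 + N%:R * h) <= 1.
Proof.
move=> /andP[h0 h1]; elim: N => [|N IHN]; first by rewrite mul0r addr0 mulr1.
apply: le_trans IHN; rewrite exprSr -mulrA ler_wpM2l ?exprn_ge0 ?subr_ge0 //.
rewrite -natr1 -subr_ge0.
rewrite (_ : _ - _ = (N%:R + 1) * h ^+ 2); last by ring.
by rewrite mulr_ge0 ?sqr_ge0 ?addr_ge0.
Qed.

Lemma divn_block (W k y : nat) : (k * W <= y < k * W + W)%N -> (y %/ W)%N = k.
Proof.
move=> /andP[le_y lt_y]; have W0 : (0 < W)%N by rewrite -(ltn_add2l (k * W)) addn0 (leq_ltn_trans le_y).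
by rewrite -(subnKC le_y) divnMDl // divn_small ?addn0 // ltn_subLR.
Qed.

Lemma window_bounds (m N : nat) : (2 * (2 * (2 * m).+1) < N)%N ->
  [/\ 0 < 2 * (2 * (2 * m).+1), m <= N, 2 * m < N & 2 * (2 * m).+1 <= N]%N.
Proof. by move=> h; split; lia. Qed.

(** Place (n / W)^d disjoint cubes that do not wrap around; by translation each of their local
    events has probability at least h. Incompleteness has probability at least 1/2 and a missed
    segment at most 1/4, so with probability at least 1/4 no local event occurs. Independence bounds
    that probability by (1 - h)^N with N the number of cubes. *)
Lemma seeded_prob x (m : nat) : let W := (2 * (2 * (2 * m).+1))%N in
  (W < n)%N -> Prob mu complete <= 1 / 2 -> miss m <= 1 / 4 ->
  ((n %/ W) ^ d)%:R * Prob mu (fun w => seeded L w x W (2 * m).+1) <= 3.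
Proof.
move=> W Wn Pc Pm; set M := (2 * m).+1; set N1 := (n %/ W)%N.
have [W0 mn m2n _] := window_bounds Wn.
pose J := {ffun 'I_d -> 'I_N1}.
pose a (j : J) : V := [ffun i => ((j i) * W)%:R].
have aE j i : a j i = (j i * W)%N :> nat.
  rewrite ffunE Zp_nat /= modn_small // (@leq_trans (N1 * W)) //.
    by rewrite ltn_pmul2r.
  exact: leq_trunc_div.
have aW j i : (a j i + W <= n)%N.
  rewrite aE -mulSnr (@leq_trans (N1 * W)) ?leq_trunc_div // leq_pmul2r //.
have dis (j j' : J) : j != j' -> [disjoint cube (a j) W & cube (a j') W].
  move=> jj'; rewrite -setI_eq0; apply/eqP/setP => y; rewrite [RHS]inE.
  apply/negP => /setIP[/cubeP yj /cubeP yj']; case/eqP: jj'; apply/ffunP => i.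
  apply: ord_inj; have := sub_val (yj' i) (aW j' i); have := sub_val (yj i) (aW j i).
  rewrite !aE.
  by move=> /divn_block <- /divn_block ->.
set h := Prob _ _; pose hj j := Prob mu (fun w => seeded L w (a j) W M).
have h_le j : h <= hj j.
  rewrite /h /hj ProbE; set s := [ffun i => (a j i - x i : 'I_n)].
  rewrite -(@Expect_perm _ _ p (shift s) (fun w => `[< seeded L w x W M >]%:R)); last exact: shift_inj.
  rewrite ProbE; apply: ler_Expect => // w; rewrite ler_nat.
  case: asboolP => // sx; rewrite asboolT //.
  by apply: seeded_shift sx => //; exact: aW.
have h0 : 0 <= h by exact: Prob_ge0.
have hj1 j : hj j <= 1 by exact: Prob_le1.
have none : Prob mu (fun w => forall j, ~ seeded L w (a j) W M) <= (1 - h) ^+ (N1 ^ d).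
  rewrite ProbE (@eq_Expect _ _ _ _ (fun w => \prod_j `[< ~ seeded L w (a j) W M >]%:R)); last first.
    move=> w; case: asboolP => [all|nall].
      by rewrite big1 // => j _; rewrite asboolT.
    have [j sj] : exists j, seeded L w (a j) W M.
      by apply: contrapT => nex; apply: nall => j sj; apply: nex; exists j.
    by rewrite (bigD1 j) //= asboolF ?mul0r // => /(_ sj).
  rewrite (@Expect_indep_prod _ _ p J (fun j => cube (a j) W)) //; last first.
    move=> j w w' ww'; congr (_%:R); congr nat_of_bool; rewrite !asbool_neg; congr negb.
    apply/asboolP/asboolP; apply: seeded_depends => // u uW; symmetry; exact: ww'.
  have -> : (N1 ^ d)%N = #|J| by rewrite card_ffun !card_ord.
  rewrite -prodr_const; apply: ler_prod => j _.
  by rewrite -ProbE Prob_ge0 //= Prob_compl // lerD2l lerN2 (h_le j).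
have some : 1 / 4 <= Prob mu (fun w => forall j, ~ seeded L w (a j) W M).
  (* The origin is an arbitrary choice of vacated vertex that brings [Prob_miss] into play; hitting
     after vacating implies hitting before. *)
  have : 1 / 2 <= Prob mu (fun w => (forall j, ~ seeded L w (a j) W M) \/ ~ arc_hit (vacate [ffun=> 0] w) m).
    apply: (@le_trans _ _ (Prob mu (fun w => ~ complete w))).
      by rewrite Prob_compl; lra.
    apply: ler_Prob => // w nc; apply: contrapT => /not_orP[ns /contrapT hit].
    apply: ns => j [C gC [_ iC]]; apply/nc/complete_occ.
    exact: growth d_gt1 gC m2n iC (arc_hit_vacate hit).
  move=> /le_trans/(_ (Prob_or _ _ _)) => /(_ mu_ge0) hh.
  have := Prob_miss [ffun=> 0] mn; move: hh Pm; lra.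
have h1 : h <= 1 by exact: Prob_le1.
have B := @bernoulli h (N1 ^ d) _; have {}B := B (introT andP (conj h0 h1)).
have Nh : 0 <= 1 + (N1 ^ d)%:R * h by rewrite addr_ge0 ?mulr_ge0.
have : 1 / 4 * (1 + (N1 ^ d)%:R * h) <= 1.
  by apply: le_trans B; rewrite ler_wpM2r // (le_trans some).
move: (_ * h) => z; lra.
Qed.

Lemma Prob_pivotal v (m : nat) : let W := (2 * (2 * (2 * m).+1))%N in
  (W < n)%N -> Prob mu complete <= 1 / 2 -> miss m <= 1 / 4 ->
  Prob mu (fun w => f w <> f (vacate v w)) <= miss m + 3 / ((n %/ W) ^ d)%:R.
Proof.
move=> W Wn Pc Pm.
have [W0 mn _ rn] := window_bounds Wn.
have N0 : 0 < ((n %/ W) ^ d)%:R :> R by rewrite ltr0n expn_gt0 divn_gt0 // (ltnW Wn).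
apply: le_trans (ler_Prob mu_ge0 (fun w => @pivotal_seeded v w m rn)) _.
apply: le_trans (Prob_or _ _ _) _ => //; apply: lerD; first exact: Prob_miss.
by rewrite ler_pdivlMr // mulrC; exact: seeded_prob.
Qed.

(** One fully occupied segment of 2 m + 1 vertices is a generated set large enough for [growth]. The
    estimate keeps the critical density away from 1. *)
Lemma Prob_incomplete_upper (m : nat) : (2 * m < n)%N ->
  1 - Prob mu complete <= miss m + (2 * m).+1%:R * (1 - p).
Proof.
move=> mn; pose x0 : V := [ffun=> 0]; pose i0 : 'I_d := Ordinal (ltnW d_gt1).
rewrite -Prob_compl.
pose y (s : 'I_(2 * m).+1) : V := upd x0 i0 (s : nat)%:R.
apply: (@le_trans _ _ (Prob mu (fun w => ~ arc_hit (vacate x0 w) m \/ exists s, ~~ w (y s)))).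
  apply: ler_Prob => // w nc; apply: contrapT => /not_orP[/contrapT hit nv].
  have gS : gen e w (segment x0 i0 (2 * m).+1).
    apply: gen_segment mn _ => _ /imsetP[s _ ->].
    by apply/negPn/negP => ws; apply: nv; exists s.
  have sS : exists i, (2 * m < spread (@vcoord d n0) (segment x0 i0 (2 * m).+1) i)%N.
    by exists i0; exact: spread_segment mn.
  apply/nc/complete_occ; exact: growth d_gt1 gS mn sS (arc_hit_vacate hit).
apply: le_trans (Prob_or _ _ _) _ => //; apply: lerD.
  by apply: Prob_miss; apply: leq_trans (ltnW mn); rewrite mul2n -addnn leq_addr.
apply: le_trans (Prob_exists _ _) _ => //.
rewrite mulr_natl -[X in _ *+ X]card_ord -sumr_const; apply: ler_sum => s _.
by rewrite Prob_vacant1.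
Qed.

Lemma corr_bound (eps y : R) (m K : nat) : let W := (2 * (2 * (2 * m).+1))%N in
  (W < n)%N -> Prob mu complete = 1 / 2 -> miss m <= 1 / 4 -> 0 <= eps <= 1 -> 0 <= y ->
  16 * (miss m + 3 / ((n %/ W) ^ d)%:R) ^+ 3 * (16 * (p * (1 - p))^-1) ^+ K <= y ^+ 2 ->
  `|noise_corr p eps f| <= (n ^ d)%:R * y + (1 - eps) ^+ K.
Proof.
move=> W Wn Pc Pm e01 y0 hy; rewrite -card_vertex.
apply: noise_corr_bound hy => //; first exact: fC_val.
  rewrite (@eq_Expect _ _ _ _ (fun w => 2 * `[< complete w >]%:R - 1)); last first.
    by move=> w; rewrite /fC; case: ifP => _; rewrite ?mulr0 ?mulr1; ring.
  by rewrite ExpectB ExpectZ Expect_cst -ProbE Pc; field.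
by move=> v; apply: Prob_pivotal => //; rewrite Pc.
Qed.

End Percolation.

(** At scale 3 k a generated set has at least k seeds by [gen_occupied] and lies in a cube of side
    12 k around any of its vertices; a union bound over that vertex follows. Working with p' keeps
    the base of the Markov bound positive even at p = 0. *)
Lemma Prob_complete_upper (R : realType) (L : lattice) (d n0 : nat) (p p' : R) (k : nat) :
  let n := n0.+2 in (0 < d)%N -> 0 <= p -> p <= p' -> p' <= 1 -> 0 < p' -> (0 < k)%N ->
  (6 * k <= n)%N -> p' * ((12 * k) ^ d)%:R <= 1 ->
  Prob (product_law p) (complete_occupation (adj L d n) 2) <=
    (n ^ d)%:R * (expR 1 * (p' * ((12 * k) ^ d)%:R) ^+ k).
Proof.
move=> n d0 p0 pp' p'1 p'0 k0 kn pa;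
have p01 : 0 <= p <= 1 by rewrite p0 (le_trans pp').
have mu_ge0 (w : config (vertex d n)) : 0 <= product_law p w by exact: product_law_ge0.
 set a := ((12 * k) ^ d)%:R.
have a0 : 0 < a :> R by rewrite ltr0n expn_gt0 muln_gt0 k0.
pose Q (v : vertex d n) := cube (corner v (6 * k)) (2 * (6 * k)).
apply: (@le_trans _ _ (Prob (product_law p) (fun w => exists v, (k <= #|[set u in Q v | w u]|)%N))).
  apply: ler_Prob => // w cw.
  have k3 : (0 < 3 * k <= n)%N by lia.
  have [C gC [[i iC] iC']] := complete_gen d0 cw k3.
  have [v vC] := gen_nonempty gC; exists v.
  have := leq_trans iC (gen_occupied i gC); rewrite leq_pmul2l // => /leq_trans; apply.
  apply: subset_leq_card; apply/subsetP => u; rewrite !inE => /andP[uC ->]; rewrite andbT.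
  have : C \subset Q v.
    apply: conn_in_cube => //; first exact: (gen_conn (@adj_sym _ _ _) gC).
    by move=> j; have := iC' j; rewrite mulnA.
  by move=> /subsetP/(_ u uC); rewrite inE.
apply: le_trans (Prob_exists _ _) _ => //.
rewrite -(card_vertex d n0) mulr_natl -sumr_const; apply: ler_sum => v _.
apply: Prob_many_occupied => //; rewrite ler_nat /Q.
by apply: leq_trans (card_cube _ _) _; rewrite mulnA.
Qed.

(** * Critical density *)

Section CriticalDensity.
Variables (R : realType) (V : finType) (e : rel V) (k : nat).
Local Notation P := (fun p : R => Prob (product_law p) (complete_occupation e k)).

(** This supplies the continuity in p used to evaluate the probability at the critical density. *)
Lemma Prob_horner (A : config V -> Prop) :
  exists q : {poly R}, forall p, Prob (product_law p) A = q.[p].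
Proof.
exists (\sum_(w : config V | `[< A w >]) \prod_v (if w v then 'X else 1 - 'X)) => p.
rewrite horner_sum; apply: eq_bigr => w _; rewrite horner_prod.
by apply: eq_bigr => v _; case: ifP; rewrite !hornerE.
Qed.

(** By continuity, a value above 1/2 at the infimum would put a smaller density into the set, and a
    value below 1/2 would exclude the elements of the set close to the infimum. The exact value 1/2
    makes the Boolean function centred. *)
Lemma p_c_half (p0 p1 : R) : 0 < p0 -> (forall p, 0 <= p <= p0 -> P p < 1 / 2) ->
  0 <= p1 <= 1 -> 1 / 2 <= P p1 ->
  [/\ p0 <= p_c R e k, p_c R e k <= p1 & P (p_c R e k) = 1 / 2].
Proof.
move=> p0_gt0 low p1_01 high; rewrite /p_c.
set S := [set p | _]%classic; set pc := inf S.
have Sp1 : S p1 by [].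
have lbS : lbound S p0.
  move=> p [/andP[p_ge0 p_le1] Pp]; rewrite leNgt; apply/negP => pp0.
  by move: Pp; rewrite leNgt low // p_ge0 ltW.
have infS : has_inf S by split; [exists p1|exists p0].
have p0pc : p0 <= pc by apply: lb_le_inf lbS; exists p1.
have pcp1 : pc <= p1 by apply: ge_inf => //; exists p0.
have pc01 : 0 <= pc <= 1.
  by rewrite (le_trans (ltW p0_gt0)) //=; case/andP: p1_01 => _; exact: le_trans.
split=> //; have [q qE] := Prob_horner (complete_occupation e k).
have cq := @continuous_horner _ q pc.
apply/eqP; rewrite eq_le; apply/andP; split; rewrite qE leNgt; apply/negP => h.
  have npc : nbhs pc [set x | 1 / 2 < q.[x]]%classic := cvgr_gt _ cq _ h.
  have [dl /= dl0 near_pc] := (nbhs_ballP _ _).1 (npc _).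
  pose p := Num.max 0 (pc - dl / 2).
  have p_ge0 : 0 <= p by rewrite le_max lexx.
  have ppc : p < pc by rewrite gt_max (lt_le_trans p0_gt0) //=; lra.
  have pdl : pc - dl / 2 <= p by rewrite le_max lexx orbT.
  have : S p.
    split; first by rewrite p_ge0 /= (le_trans (ltW ppc)) //; case/andP: pc01.
    rewrite qE ltW //; apply: near_pc => /=.
    by rewrite /ball /= ger0_norm; lra.
  by move=> /(ge_inf (ex_intro _ p0 lbS)); rewrite leNgt ppc.
have npc : nbhs pc [set x | q.[x] < 1 / 2]%classic := cvgr_lt _ cq _ h.
have [dl /= dl0 near_pc] := (nbhs_ballP _ _).1 (npc _).
have [s [s01 Ps] spc] := inf_adherent dl0 infS.
have pcs : pc <= s by apply: ge_inf => //; exists p0.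
have : q.[s] < 1 / 2.
  by apply: near_pc; rewrite /ball /= ler0_norm; rewrite -/pc in spc; lra.
by rewrite ltNge -qE Ps.
Qed.

End CriticalDensity.

(** * Asymptotic estimates in n *)

Section Asymptotics.
Variable R : realType.
Implicit Types (c : R) (n : nat).
Local Notation l n := (ln (n%:R : R)).
Local Notation ll n := (ln (ln (n%:R : R))).

Lemma near_ln_ge c : \forall n \near \oo%classic, c <= l n.
Proof.
near=> n; have hn : expR c <= n%:R by near: n; exact: nbhs_infty_ger.
by rewrite -[c]expRK ler_ln ?posrE ?expR_gt0 // (lt_le_trans (expR_gt0 c)).
Unshelve. all: by end_near. Qed.

Lemma near_lnln_ge c : \forall n \near \oo%classic, c <= ll n.
Proof.
near=> n; have hn : expR c <= l n by near: n; exact: near_ln_ge.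
by rewrite -[c]expRK ler_ln ?posrE ?expR_gt0 // (lt_le_trans (expR_gt0 c)).
Unshelve. all: by end_near. Qed.

(** With t = ln ln n, this is c t <= 1 + t^2 / 2 <= exp t as soon as t >= 2 c. *)
Lemma near_lnln_le c : \forall n \near \oo%classic, c * ll n <= l n.
Proof.
near=> n; have l1 : 1 <= l n by near: n; exact: near_ln_ge.
have ll0 : 0 <= ll n by near: n; exact: near_lnln_ge.
have llc : 2 * c <= ll n by near: n; exact: near_lnln_ge.
rewrite -[leRHS]lnK ?posrE ?(lt_le_trans ltr01) //.
apply: le_trans (expR_ge1Dxn 1 ll0); move: (ll n) ll0 llc => t t0 tc.
rewrite (_ : 2`! = 2)%N //; nra.
Unshelve. all: by end_near. Qed.

Lemma exp_ln n : 1 <= l n -> n%:R = expR (l n).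
Proof.
case: n => [|n] h; last by rewrite lnK // posrE ltr0n.
by move: h; rewrite ln0 // ler10.
Qed.

Lemma expRN3 : expR (- 3) <= 1 / 4 :> R.
Proof.
rewrite expRN div1r lef_pV2 ?posrE ?expR_gt0 //.
by apply: le_trans (expR_ge1Dx _); rewrite -natr1 addrC.
Qed.

Lemma expR_gt12 (x : R) : 24 <= x -> 12 * x < expR x.
Proof.
move=> x24; have x0 : 0 <= x by lra.
apply: lt_le_trans (expR_ge1Dxn 1 x0); rewrite (_ : 2`! = 2)%N //; nra.
Qed.

Lemma linear_le_square (x y : R) : 24 <= x -> y <= x + 1 -> 2 * (y + 1) + 1 <= 1 / 4 * x ^+ 2.
Proof. by move=> *; nra. Qed.

Lemma half_le (x : R) : 1 - x <= 1 / 4 + 1 / 4 -> 1 / 2 <= x.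
Proof. lra. Qed.

Lemma mul_ge3 (c x : R) : 2 <= c -> 64 <= x -> - (c * x) <= - 3.
Proof. by move=> *; nra. Qed.

(** The exponents in the final Fourier bound, with c = d: the cube of the influence gives - 3 c x
    against - 2 c x on the right, and the surplus c x pays for the logarithmic terms and the
    fractions of x. *)
Lemma exponent_le (C c x t : R) : 2 <= c -> 64 <= x -> (3 * C + 1) * t <= x ->
  t + 3 * (C * t - c * x) + x / 8 <= 2 * (- (c * x) - x / 8).
Proof. by move=> *; nra. Qed.

Lemma noise_exponent (eps z x : R) : 0 <= eps -> eps <= 1 -> z < x + 1 ->
  0 <= 1 - eps * z - - (x * eps).
Proof. by move=> *; nra. Qed.

Lemma window_size (m : nat) : (2 * (2 * (2 * m).+1) = 8 * m + 4)%N.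
Proof. lia. Qed.

(** * Bounds on the critical density and on the correlation for large n *)

Section Thresholds.
Variables (L : lattice) (d : nat).
Hypothesis d_gt1 : (1 < d)%N.
Local Notation complete n0 := (complete_occupation (adj L d n0.+2) 2).
Local Notation Pr n0 p := (Prob (product_law (p : R)) (complete n0)).

(** Take k just above ln n in [Prob_complete_upper]. Since 12 k <= 24 ln n, the base is at most 24^d
    / ln n, eventually below exp(-(d + 2)), and its k-th power beats the factor n^d. *)
Lemma near_low : \forall n \near \oo%classic, forall n0, n = n0.+2 ->
  forall p : R, 0 <= p <= (l n ^+ d.+1)^-1 -> Pr n0 p < 1 / 2.
Proof.
near=> n; move=> n0 nE p /andP[p_ge0 p_le].
have l24 : 24 <= l n by near: n; exact: near_ln_ge.
have lc : 24 ^+ d * expR (d%:R + 2) <= l n by near: n; exact: near_ln_ge.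
have l1 : 1 <= l n by lra.
have l0 : 0 < l n by lra.
have NE := exp_ln l1; set x := l n in p_le l24 lc l1 l0 NE *.
set k := (Num.truncn x).+1.
have xk : x <= k%:R by rewrite ltW // truncnS_gt.
have kx : k%:R <= 2 * x.
  rewrite /k -natr1; have /andP[+ _] := truncn_itv (ltW l0); lra.
pose p' := (x ^+ d.+1)^-1.
have p'0 : 0 < p' by rewrite invr_gt0 exprn_gt0.
set a : R := p' * ((12 * k) ^ d)%:R.
have aE : a <= expR (- (d%:R + 2)).
  apply: (@le_trans _ _ (24 ^+ d / x)).
    have kd : ((12 * k) ^ d)%:R <= (24 * x) ^+ d :> R.
      by rewrite natrX natrM lerXn2r ?nnegrE ?mulr_ge0 ?ler0n //; lra.
    apply: le_trans (ler_wpM2l (ltW p'0) kd) _; rewrite le_eqVlt; apply/orP; left; apply/eqP.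
    have := exprn_gt0 d l0; rewrite /p' exprMn exprS; move: (x ^+ d) => u u0.
    by field; rewrite !gt_eqF.
  by rewrite ler_pdivrMr // mulrC expRN ler_pdivlMr ?expR_gt0.
have a1 : a <= 1.
  by apply: le_trans aE _; rewrite -expR0 ler_expR oppr_le0 addr_ge0.
have kn : (6 * k <= n0.+2)%N.
  rewrite -(ler_nat R) -nE natrM NE; apply: le_trans (ltW (expR_gt12 l24)); lra.
have p'1 : p' <= 1 by rewrite invf_le1 ?exprn_gt0 // exprn_ege1.
have := @Prob_complete_upper R L d n0 p p' k (ltnW d_gt1) p_ge0 p_le p'1 p'0 (ltn0Sn _) kn a1.
move=> /le_lt_trans; apply; rewrite -/a -nE natrX NE.
apply: (@le_lt_trans _ _ (expR (- 3))); last first.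
  by apply: le_lt_trans expRN3 _; lra.
have a0 : 0 <= a by rewrite mulr_ge0 // ltW.
apply: (@le_trans _ _ (expR x ^+ d * (expR 1 * expR (- (d%:R + 2)) ^+ k))).
  rewrite ler_pM2l ?exprn_gt0 ?expR_gt0 // ler_pM2l ?expR_gt0 //.
  by rewrite lerXn2r ?nnegrE ?expR_ge0.
rewrite -!expRM_natl -!expRD ler_expR.
have d0 : 0 <= d%:R :> R by [].
have := ler_wpM2l d0 xk; lra.
Unshelve. all: by end_near. Qed.

(** Take m - 1 just above ln n in [Prob_incomplete_upper]: the segment term is of order 1 / ln n,
    and (ln n)^(-2 (m - 1)) beats d n^d. *)
Lemma near_high : \forall n \near \oo%classic, forall n0, n = n0.+2 ->
  0 <= 1 - (l n ^+ 2)^-1 <= 1 /\ 1 / 2 <= Pr n0 (1 - (l n ^+ 2)^-1).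
Proof.
near=> n; move=> n0 nE.
have l24 : 24 <= l n by near: n; exact: near_ln_ge.
have lc : expR (d%:R + 2) <= l n by near: n; exact: near_ln_ge.
have ld : d%:R <= l n by near: n; exact: near_ln_ge.
have l1 : 1 <= l n by lra.
have l0 : 0 < l n by lra.
have NE := exp_ln l1; set x := l n in l24 lc ld l1 l0 NE *.
have x20 : 0 < x ^+ 2 by rewrite exprn_gt0.
have xx : x <= x ^+ 2 by rewrite expr2 ler_peMr // ltW.
have q1 : (x ^+ 2)^-1 < 1 by rewrite invf_lt1 //; nra.
have q0 : 0 < (x ^+ 2)^-1 by rewrite invr_gt0.
split; first by apply/andP; split; lra.
set k := (Num.truncn x).+1.
have xk : x <= k%:R by rewrite ltW // truncnS_gt.
have kx : k%:R <= x + 1.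
  rewrite /k -natr1; have /andP[+ _] := truncn_itv (ltW l0); lra.
have kn : (2 * k.+1 < n0.+2)%N.
  rewrite -(ltr_nat R) -nE natrM NE -natr1; apply: le_lt_trans (expR_gt12 l24); lra.
have p0 : 0 < 1 - (x ^+ 2)^-1 by lra.
have p1 : 1 - (x ^+ 2)^-1 < 1 by lra.
have := @Prob_incomplete_upper R L d n0 _ d_gt1 p0 p1 _ kn.
rewrite /miss succnK subKr -nE.
have h1 : (d * n ^ d)%:R * (x ^+ 2)^-1 ^+ k <= 1 / 4.
  apply: (@le_trans _ _ (x * expR (d%:R * x) * expR (- (d%:R + 2)) ^+ k)).
    rewrite natrM natrX NE expRM_natl; apply: ler_pM => //.
    - by rewrite exprn_ge0 // ltW.
    - by rewrite ler_wpM2r // exprn_ge0 // expR_ge0.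
    - rewrite lerXn2r ?nnegrE ?expR_ge0 ?(ltW q0) // expRN lef_pV2 ?posrE ?expR_gt0 //.
      exact: le_trans lc xx.
  apply: le_trans expRN3; rewrite -expRM_natl.
  apply: (@le_trans _ _ (expR x * expR (d%:R * x) * expR (k%:R * - (d%:R + 2)))).
    rewrite ler_pM2r ?expR_gt0 // ler_pM2r ?expR_gt0 //.
    by apply: le_trans (ltW (expR_gt12 l24)); lra.
  rewrite -!expRD ler_expR.
  have d0 : 0 <= d%:R :> R by [].
  have := ler_wpM2l d0 xk; lra.
have h2 : (2 * k.+1).+1%:R * (x ^+ 2)^-1 <= 1 / 4.
  by rewrite ler_pdivrMr // -natr1 natrM -[k.+1%:R]natr1; exact: linear_le_square.
by move=> /le_trans/(_ (lerD h1 h2)); exact: half_le.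
Unshelve. all: by end_near. Qed.

Lemma near_corr : \forall n \near \oo%classic, forall n0, n = n0.+2 ->
  forall p eps : R, (l n ^+ d.+1)^-1 <= p -> p <= 1 - (l n ^+ 2)^-1 ->
  Pr n0 p = 1 / 2 -> 0 <= eps <= 1 ->
  `|noise_corr p eps (fC (adj L d n0.+2) 2 R)| <=
    expR (- (l n / 8)) + expR (1 - eps * l n / ll n / (8 * (d + 4))%:R).
Proof.
(* Cubes of side at most (ln n)^(d + 4) cost (ln n)^(d (d + 4)) in the influence; one more factor ln
   n absorbs the constants. *)
pose C := (d * (d + 4)).+1.
near=> n; move=> n0 nE p eps p_ge p_le Pp /andP[e0 e1].
have l64 : 64 <= l n by near: n; exact: near_ln_ge.
have ld : (2 * d).+1%:R <= l n by near: n; exact: near_ln_ge.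
have t1 : 1 <= ll n by near: n; exact: near_lnln_ge.
have tC : (3 * C).+1%:R * ll n <= l n by near: n; exact: near_lnln_le.
have td : (d + 4)%:R * ll n <= l n by near: n; exact: near_lnln_le.
have l1 : 1 <= l n by lra.
have l0 : 0 < l n by lra.
have l16 : 16 <= l n by lra.
have NE := exp_ln l1; set x := l n in p_ge p_le l64 ld t1 tC td l1 l0 l16 NE *.
have xE : x = expR (ln x) by rewrite lnK.
set t := ln x in xE t1 tC td *.
have t0 : 0 < t := lt_le_trans ltr01 t1.
have d0 : 0 <= d%:R :> R by [].
have d2 : 2 <= d%:R :> R by rewrite ler_nat.
(* As p >= x^-(d + 1), this gives p A >= x^2, so a vacant segment of length A has probability at
   most exp(- x^2), below every power of n. *)
set A := x ^+ (d + 3).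
have A0 : 0 < A by rewrite exprn_gt0.
have A1 : 1 <= A by rewrite exprn_ege1.
(* Two above the integer part, so that m - 1, the exponent in [miss], is still at least A. *)
set m := (Num.truncn A).+2.
have Am : A <= m.-1%:R by rewrite ltW // /m succnK truncnS_gt.
have mA : m%:R <= A + 2.
  by rewrite /m -!natr1; have /andP[+ _] := truncn_itv (ltW A0); lra.
set W := (2 * (2 * (2 * m).+1))%N.
have WE : W%:R = 8 * m%:R + 4 :> R.
  by rewrite /W window_size natrD natrM.
(* The factor 2 leaves room for rounding n / W down. *)
have WA : 2 * W%:R <= expR ((d + 4)%:R * t).
  rewrite expRM_natl -xE (_ : (d + 4 = (d + 3).+1)%N); last by rewrite addnS.
  rewrite exprS -/A WE; have := ler_wpM2r (ltW A0) l64; lra.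
have WN : 2 * W%:R <= n%:R :> R by apply: le_trans WA _; rewrite NE ler_expR.
have W0 : (0 < W)%N by rewrite /W muln_gt0 //= muln_gt0.
have W0R : 0 < W%:R :> R by rewrite ltr0n.
have Wn : (W < n0.+2)%N by rewrite -nE -(ltr_nat R); lra.
set q := (n %/ W)%N.
have qN : expR (x - (d + 4)%:R * t) <= q%:R.
  have : n%:R <= (q%:R + 1) * W%:R :> R.
    by rewrite natr1 -natrM ler_nat ltnW // /q ltn_ceil.
  rewrite expRD expRN ler_pdivrMr ?expR_gt0 // -NE => h.
  apply: (@le_trans _ _ (q%:R * (2 * W%:R))); last by rewrite ler_wpM2l.
  lra.
have missE : miss d n0 p m <= expR (- (d%:R * x)).
  rewrite /miss -nE natrM natrX NE.
  apply: (@le_trans _ _ (x * expR (d%:R * x) * expR (- x ^+ 2))).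
    rewrite expRM_natl; apply: ler_pM.
    - by rewrite mulr_ge0 // exprn_ge0 // expR_ge0.
    - rewrite exprn_ge0 // subr_ge0; apply: le_trans p_le _.
      by rewrite lerBlDr lerDl invr_ge0 exprn_ge0 // ltW.
    - rewrite ler_wpM2r ?exprn_ge0 ?expR_ge0 //; apply: le_trans ld.
      by rewrite ler_nat ltnW // ltnS leq_pmull.
    - apply: (@le_trans _ _ (expR (- p) ^+ m.-1)).
        rewrite lerXn2r ?nnegrE ?expR_ge0 //; last exact: expR_ge1Dx.
        rewrite subr_ge0; apply: le_trans p_le _.
        by rewrite lerBlDr lerDl invr_ge0 exprn_ge0 // ltW.
      rewrite -expRM_natl ler_expR mulrN lerN2.
      apply: le_trans (ler_pM _ _ Am p_ge); rewrite ?(ltW A0) ?invr_ge0 ?exprn_ge0 ?(ltW l0) //.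
      rewrite /A (_ : (d + 3 = 2 + d.+1)%N); last by rewrite addnC addnS.
      by rewrite exprD mulfK // gt_eqF // exprn_gt0.
  apply: (@le_trans _ _ (expR x * expR (d%:R * x) * expR (- x ^+ 2))).
    rewrite ler_pM2r ?expR_gt0 // ler_pM2r ?expR_gt0 //.
    by apply: le_trans (expR_ge1Dx _); lra.
  rewrite -!expRD ler_expR.
  have := ler_wpM2r (ltW l0) ld; rewrite -natr1 natrM => h.
  by rewrite expr2; lra.
set a := miss d n0 p m + 3 / (q ^ d)%:R.
have a0 : 0 <= a.
  rewrite addr_ge0 ?divr_ge0 // /miss mulr_ge0 // exprn_ge0 // subr_ge0.
  by apply: le_trans p_le _; rewrite lerBlDr lerDl invr_ge0 exprn_ge0 // ltW.
have aE : a <= expR (C%:R * t - d%:R * x).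
  have qE : 3 / (q ^ d)%:R <= 3 * expR ((d * (d + 4))%:R * t - d%:R * x).
    rewrite ler_pM2l // -[_ - _]opprK expRN lef_pV2 ?posrE ?expR_gt0 //; last first.
      by rewrite ltr0n expn_gt0 (_ : (0 < q)%N) // -(ltr0n R) (lt_le_trans (expR_gt0 _) qN).
    rewrite natrX opprB (_ : _ - _ = d%:R * (x - (d + 4)%:R * t)); last by rewrite natrM; ring.
    by rewrite expRM_natl lerXn2r ?nnegrE ?expR_ge0.
  rewrite /C -natr1 mulrDl mul1r addrAC expRD -xE.
  apply: le_trans (lerD missE qE) _.
  set u := expR (_ * t - _) in qE *; set v := expR _.
  have vu : v <= u by rewrite ler_expR lerDr mulr_ge0 //; lra.
  have u0 : 0 < u by exact: expR_gt0.
  nra.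
have x20 : 0 < x ^+ 2 by rewrite exprn_gt0.
have xd0 : 0 < x ^+ d.+1 by rewrite exprn_gt0.
have p_gt0 : 0 < p by apply: lt_le_trans p_ge; rewrite invr_gt0.
have q_ge : (x ^+ 2)^-1 <= 1 - p by lra.
have q_gt0 : 0 < 1 - p by apply: lt_le_trans q_ge; rewrite invr_gt0.
have p_lt1 : p < 1 by lra.
(* The exponent d + 4 is 1 + (d + 1) + 2, from 16 <= x, 1 / p <= x^(d + 1) and 1 / (1 - p) <=
   x^2. *)
have DE : 16 * (p * (1 - p))^-1 <= expR ((d + 4)%:R * t).
  rewrite expRM_natl -xE (_ : (d + 4 = (d.+1 + 2).+1)%N); last by rewrite addSn -!addnS.
  rewrite exprS; apply: ler_pM => //; [by rewrite invr_ge0 mulr_ge0 // ltW|].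
  rewrite exprD -[leRHS]invrK lef_pV2 ?posrE ?mulr_gt0 ?invr_gt0 ?mulr_gt0 //.
  by rewrite invfM; apply: ler_pM; rewrite ?invr_ge0 ?(ltW xd0) ?(ltW x20).
set c : R := (8 * (d + 4))%:R.
have cE : c = 8 * (d + 4)%:R by rewrite /c natrM.
have d40 : 0 < (d + 4)%:R :> R by rewrite ltr0n addn_gt0 orbT.
have c0 : 0 < c by rewrite cE mulr_gt0.
(* Chosen so that z (d + 4) t = x / 8: the degree K, its integer part, costs at most n^(1/8) in the
   Bonami factor. *)
set z := x / t / c; have z0 : 0 <= z by rewrite !divr_ge0 // ltW.
set K := Num.truncn z.
have /andP[Kz zK] := truncn_itv z0; rewrite -/K in Kz zK.
have KE : (16 * (p * (1 - p))^-1) ^+ K <= expR (x / 8).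
  apply: (@le_trans _ _ (expR ((d + 4)%:R * t) ^+ K)).
    by rewrite lerXn2r ?nnegrE ?expR_ge0 // mulr_ge0 // invr_ge0 mulr_ge0 // ltW.
  rewrite -expRM_natl ler_expR.
  apply: (@le_trans _ _ (z * ((d + 4)%:R * t))).
    by rewrite ler_wpM2r // mulr_ge0 // ltW.
  rewrite /z cE le_eqVlt; apply/orP; left; apply/eqP; field.
  by rewrite !gt_eqF.
(* This is n^(-d - 1/8), so the total low-degree weight n^d y is n^(-1/8). *)
pose y := expR (- (d%:R * x) - x / 8).
have y0 : 0 <= y by exact: expR_ge0.
have miss4 : miss d n0 p m <= 1 / 4.
  apply: le_trans missE _; apply: le_trans expRN3; rewrite ler_expR; exact: mul_ge3.
have ay : 16 * a ^+ 3 * (16 * (p * (1 - p))^-1) ^+ K <= y ^+ 2.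
  apply: (@le_trans _ _ (x * expR (C%:R * t - d%:R * x) ^+ 3 * expR (x / 8))).
    apply: ler_pM => //.
    - by rewrite mulr_ge0 // exprn_ge0.
    - by rewrite exprn_ge0 // mulr_ge0 // invr_ge0 mulr_ge0 // ltW.
    - apply: ler_pM => //; [by rewrite exprn_ge0|].
      by rewrite lerXn2r ?nnegrE ?expR_ge0.
  rewrite {1}xE /y -!expRM_natl -!expRD ler_expR.
  by apply: exponent_le => //; rewrite -[3]/(3%:R) -natrM natr1.
have ay' : 16 * (miss d n0 p m + 3 / ((n0.+2 %/ W) ^ d)%:R) ^+ 3 *
    (16 * (p * (1 - p))^-1) ^+ K <= y ^+ 2 by rewrite -nE; exact: ay.
have := @corr_bound R L d n0 p d_gt1 p_gt0 p_lt1 eps y m K Wn Pp miss4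
  (introT andP (conj e0 e1)) y0 ay'.
move=> /le_trans; apply.
apply: lerD.
  by rewrite -nE natrX NE /y -expRM_natl -expRD ler_expR addrA subrr sub0r.
apply: (@le_trans _ _ (expR (- eps) ^+ K)).
  by rewrite lerXn2r ?nnegrE ?expR_ge0 ?subr_ge0 //; exact: expR_ge1Dx.
(* Rounding z down to K loses less than eps <= 1 in the exponent, whence the summand 1 in the
   bound. *)
rewrite -expRM_natl ler_expR mulrN -subr_ge0.
rewrite (_ : eps * x / t / c = eps * z); last by rewrite /z !mulrA.
by rewrite -natr1 in zK; exact: noise_exponent.
Unshelve. all: by end_near. Qed.

End Thresholds.

End Asymptotics.

(** * Passage to the limit *)

Local Open Scope classical_set_scope.
Local Open Scope ring_scope.

Lemma cvg_expRN (R : realType) (u : nat -> R) : u n @[n --> \oo] --> +oo ->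
  expR (- u n) @[n --> \oo] --> (0 : R).
Proof. by move=> uoo; exact: cvg_comp uoo (@cvgr_expR R). Qed.

Theorem theorem1p2 (R : realType) (d : nat) (L : lattice) (eps : nat -> R)
  (hd : (2 <= d)%N)
  (heps : forall n : nat, (0 < n)%N -> 0 < eps n <= 1)
  (hgg : eps n * ln (n%:R : R) / ln (ln (n%:R : R)) @[n --> \oo] --> +oo) :
  noise_corr (p_c R (adj L d n) 2) (eps n) (fC (adj L d n) 2 R)
    @[n --> \oo] --> (0 : R).
Proof.
pose c : R := (8 * (d + 4))%:R.
have c0 : 0 < c by rewrite ltr0n muln_gt0 /= addn_gt0 orbT.
pose u n := eps n * ln (n%:R : R) / ln (ln (n%:R : R)).
(* The first summand is n^(-1/8) for n >= 1; the second vanishes because the noise hypothesis says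
   that u tends to infinity. *)
pose b n := expR (- (ln (n%:R : R) / 8)) + expR (1 - u n / c).
have b0 : b n @[n --> \oo] --> (0 : R).
  rewrite -[X in _ --> X]addr0; apply: cvgD.
    apply: cvg_expRN; apply/cvgryPge => A; near=> n.
    by rewrite ler_pdivlMr //; near: n; exact: near_ln_ge.
  have -> : (fun n => expR (1 - u n / c)) = (fun n => expR (- (u n / c - 1))).
    by apply/funext => n; rewrite opprB.
  apply: cvg_expRN; apply/cvgryPge => A; near=> n.
  by rewrite lerBrDr ler_pdivlMr //; near: n; move/cvgryPge : hgg; exact.
apply: (@squeeze_cvgr _ _ _ _ (fun n => - b n) b); last exact: b0; last first.
  by rewrite -oppr0; exact: cvgN.
near=> n; rewrite -ler_norml.
have n2 : (2 <= n)%N by near: n; exact: nbhs_infty_ge.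
have low : forall n0, n = n0.+2 -> forall p : R, 0 <= p <= (ln (n%:R : R) ^+ d.+1)^-1 ->
    Prob (product_law p) (complete_occupation (adj L d n0.+2) 2) < 1 / 2.
  by near: n; exact: near_low.
have high : forall n0, n = n0.+2 -> 0 <= 1 - (ln (n%:R : R) ^+ 2)^-1 <= 1 /\
    1 / 2 <= Prob (product_law (1 - (ln (n%:R : R) ^+ 2)^-1)) (complete_occupation (adj L d n0.+2) 2).
  by near: n; exact: near_high.
have corr : forall n0, n = n0.+2 -> forall p e : R, (ln (n%:R : R) ^+ d.+1)^-1 <= p ->
    p <= 1 - (ln (n%:R : R) ^+ 2)^-1 ->
    Prob (product_law p) (complete_occupation (adj L d n0.+2) 2) = 1 / 2 -> 0 <= e <= 1 ->
    `|noise_corr p e (fC (adj L d n0.+2) 2 R)| <=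
    expR (- (ln (n%:R : R) / 8)) + expR (1 - e * ln (n%:R : R) / ln (ln (n%:R : R)) / c).
  by near: n; exact: near_corr.
have l1 : 1 <= ln (n%:R : R) by near: n; exact: near_ln_ge.
have l0 : 0 < ln (n%:R : R) by exact: lt_le_trans l1.
have e01 : 0 <= eps n <= 1.
  by have /andP[/ltW -> ->] := heps n (ltnW n2).
have [n0 nE] : exists n0, n = n0.+2 by exists n.-2; case: (n) n2 => [|[]].
have [p1_01 Pp1] := high n0 nE.
have p0_gt0 : 0 < (ln (n%:R : R) ^+ d.+1)^-1 by rewrite invr_gt0 exprn_gt0.
(* The two thresholds enclose the critical density in the range where the correlation estimate
   holds, and its probability of complete occupation is exactly 1/2. *)
have [p0pc pcp1 Ppc] := p_c_half p0_gt0 (low n0 nE) p1_01 Pp1.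
have := corr n0 nE _ _ p0pc pcp1 Ppc e01.
rewrite /b /u; case: _ / nE; exact.
Unshelve. all: by end_near. Qed.
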